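(* There exist universal constants $c_1, c_2 > 0$ such that for every integer $n \ge 1$, if $\pi, \sigma \in S_n$ are selected independently and uniformly at random, then $$c_1 (0.708)^n \le P(\pi \le \sigma) \le \frac{c_2}{n^2},$$ where $\le$ between permutations denotes the (strong) Bruhat order on $S_n$.
   Context: $S_n$ is the set of permutations of $[n] = \{1,\dots,n\}$, written in one-line notation $\omega = \omega(1)\cdots\omega(n)$. A reduction of $\omega \in S_n$ is a permutation obtained from $\omega$ by interchanging some $\omega(i)$ with some $\omega(j)$, where $i<j$ and $\omega(i) > \omega(j)$. In the Bruhat order, $\pi \le \sigma$ if there is a chain $\sigma = \omega_1 \to \omega_2 \to \cdots \to \omega_s = \pi$ ($s \ge 1$), where each $\omega_t$ ($2\le t\le s$) is a reduction of $\omega_{t-1}$ (in particular $\pi\le\pi$). *)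

(* Defs.v *)
From mathcomp Require Import all_boot all_order all_fingroup all_algebra.
From mathcomp Require Import reals.

Set Implicit Arguments.
Unset Strict Implicit.
Unset Printing Implicit Defensive.

Import Order.TTheory GRing.Theory Num.Theory.
Local Open Scope ring_scope.

(* Permutations act on {0, ..., n-1} rather than on {1, ..., n}. Products of
   permutations apply the left factor first, so the one-line notation of
   tperm i j * w is that of w with the entries in positions i and j exchanged
   (see reductionE). *)
Definition reduction n (w w' : 'S_n) : bool :=
  [exists i : 'I_n, exists j : 'I_n,
    [&& (i < j)%N, (w j < w i)%N & w' == (tperm i j * w)%g]].

Lemma reductionE n (w : 'S_n) (i j : 'I_n) :
  [/\ (tperm i j * w)%g i = w j, (tperm i j * w)%g j = w i
    & forall k, k != i -> k != j -> (tperm i j * w)%g k = w k].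
Proof.
split=> [||k ki kj]; rewrite permM ?tpermL ?tpermR //.
by rewrite tpermD // eq_sym.
Qed.

Definition bruhat_le n (p s : 'S_n) : bool := connect (@reduction n) s p.

Definition unif (R : realType) (T : finType) (x : T) : R := #|T|%:R^-1.

(* Probability that two independent uniform elements x, y of T satisfy E x y:
   the joint law is the product of the two uniform laws. *)
Definition indep_unif_prob (R : realType) (T : finType) (E : rel T) : R :=
  \sum_(xy : T * T | E xy.1 xy.2) unif R xy.1 * unif R xy.2.

(* Main.v *)
Require Import Defs.
From mathcomp Require Import all_boot all_order all_fingroup all_algebra.
From mathcomp Require Import reals.
From mathcomp Require Import zify ring lra.

Set Implicit Arguments.
Unset Strict Implicit.
Unset Printing Implicit Defensive.

Import Order.TTheory GRing.Theory Num.Theory.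
Local Open Scope ring_scope.

(** Write r_w(i, j) for the number of positions p < i with w p < j. A
    permutation p is below s in the Bruhat order exactly when r_s <= r_p
    everywhere (bruhat_leE). Inserting a first letter in each word shows that the
    probability P_n of this event satisfies P_(n+1) >= P_n / 2
    (prob_everywhere_half), so that up to constants n may be taken in any fixed
    arithmetic progression.

    Upper bound, n = 2 h. Let k be the number of entries of p in the lower left
    quadrant, of side h. Given k, the set of positions of the h smallest values
    and the set of values at the h first positions are independent, and in each
    half they are uniform among the sets of the prescribed size
    (quadrant_independent). If p is below s, comparing the middle row and the
    middle column of the rank functions gives four ballot conditions between a
    uniform k-subset and a uniform l-subset of h points, independent given the
    quadrant counts k of p and l of s (quadrant_pairs_le). By the reflection
    principle each has probability at most
    (k - l + 1) (h + 1) / ((k + 1) (h - l + 1)) (ballots_ratio). As k and l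
    deviate from h / 2 by about the square root of h, this is of order h^(-1/2),
    and its fourth power of order h^(-2); the fourth moment of k (sum_dev4)
    makes this precise.

    Lower bound. Building a permutation from independent insertions, in a way
    that is monotone for the Bruhat order, gives a Harris inequality
    (harris_perm): the events that r_s <= r_p on various regions are positively
    correlated (prob_dominatesI). By symmetry P_n is therefore at least the
    fourth power of the probability of domination on one quadrant. Take
    h = 600 t. In the quadrant, the first 60 t rows and the first 60 t columns
    cost a factor at least 2^(-60 t) each (prob_rows_ge). For the remaining
    indices, suppose that p has 315 t entries in the quadrant and s only 285 t,
    which costs (19 / 21)^(60 t) up to a polynomial factor. Given these counts,
    Chebyshev's inequality keeps r_p and r_s close to their means at the points
    of a 600 by 600 grid; the means are separated by a multiple of t large
    enough to cover what happens inside the cells of the grid (prob_bulk). In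
    total P_(1200 t) is at least 2^(-480 t) (19 / 21)^(240 t) divided by a
    polynomial, and this beats 0.708^(1200 t). *)

(** * Rank functions and the Bruhat order *)

Section Rank.
Local Open Scope nat_scope.

Definition rk n (w : 'S_n) (i j : nat) : nat :=
  \sum_(p < n) ((p < i) && (w p < j)).

Lemma sum_ltn n i : \sum_(p < n) (p < i) = minn i n.
Proof.
elim: n => [|n IH]; first by rewrite big_ord0 minn0.
by rewrite big_ord_recr /= IH; lia.
Qed.

Lemma rk_mono n (w : 'S_n) i i' j j' : i <= i' -> j <= j' -> rk w i j <= rk w i' j'.
Proof.
move=> ii jj; apply: leq_sum => p _.
case: ltnP => //= pi; case: ltnP => //= wj.
by rewrite (leq_trans pi ii) (leq_trans wj jj).
Qed.

Lemma rk_le_row n (w : 'S_n) i j : rk w i j <= i.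
Proof.
apply: (@leq_trans (\sum_(p < n) (p < i))); last by rewrite sum_ltn geq_minl.
by apply: leq_sum => p _; case: (p < i) => //=; apply: leq_b1.
Qed.

Lemma rk_inv n (w : 'S_n) i j : rk w^-1%g i j = rk w j i.
Proof.
rewrite /rk (reindex_inj (@perm_inj _ w)).
by apply: eq_bigr => p _; rewrite permK andbC.
Qed.

Lemma rk0 n (w : 'S_n) j : rk w 0 j = 0.
Proof. by apply/eqP; rewrite -leqn0 rk_le_row. Qed.

Lemma rk_min n (w : 'S_n) i j : rk w i j = rk w (minn i n) (minn j n).
Proof.
apply: eq_bigr => p _.
by rewrite !leq_min !ltn_ord !andbT.
Qed.

(** Distinct positions carry distinct values, so each new value adds at most
    one hit. *)
Lemma rk_lipschitz n (w : 'S_n) i j j' : j <= j' -> rk w i j' + j <= rk w i j + j'.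
Proof.
move=> jj.
have H : rk w i j' <= rk w i j + \sum_(q < n) ((q < j') && ~~ (q < j)).
  rewrite (reindex_inj (@perm_inj _ w)) /= -big_split /=.
  by apply: leq_sum => p _; case: (p < i); case: (w p < j); case: (w p < j').
have E : \sum_(q < n) ((q < j') && ~~ (q < j)) + \sum_(q < n) (q < j) = \sum_(q < n) (q < j').
  rewrite -big_split /=; apply: eq_bigr => q _.
  by move: jj; case: (ltnP q j); case: (ltnP q j'); lia.
rewrite !sum_ltn in E.
suff : j' - j >= minn j' n - minn j n by lia.
lia.
Qed.

Definition rev_perm n : 'S_n := perm (@rev_ord_inj n).

Lemma rev_permE n (p : 'I_n) : rev_perm n p = rev_ord p.
Proof. by rewrite permE. Qed.

Lemma rk_revr n (w : 'S_n) i j : i <= n -> j <= n ->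
  rk (w * rev_perm n)%g i j + rk w i (n - j) = i.
Proof.
move=> ni nj; rewrite -[RHS](minn_idPl ni) -sum_ltn -big_split /=.
apply: eq_bigr => p _; rewrite permM rev_permE /=.
have := ltn_ord (w p); case: (p < i) => //=; lia.
Qed.

Lemma rk_revl n (w : 'S_n) i j : i <= n -> j <= n ->
  rk (rev_perm n * w)%g i j + rk w (n - i) j = j.
Proof.
move=> ni nj; rewrite -!(rk_inv w) -rk_inv invMg.
have -> : (rev_perm n)^-1%g = rev_perm n.
  by apply/permP => p; apply: (@perm_inj _ (rev_perm n)); rewrite permKV !rev_permE rev_ordK.
exact: rk_revr.
Qed.

(** The region P lets the full comparison of rank functions be split into
    events of which the probabilities multiply up to an inequality. *)
Definition dominates n (P : nat -> nat -> bool) (p s : 'S_n) : bool :=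
  [forall i : 'I_n.+1, forall j : 'I_n.+1, P i j ==> (rk s i j <= rk p i j)].

Lemma dominatesP n (P : nat -> nat -> bool) (p s : 'S_n) :
  reflect (forall i j, i <= n -> j <= n -> P i j -> rk s i j <= rk p i j)
          (dominates P p s).
Proof.
apply: (iffP idP) => [/forallP H i j ni nj Pij|H].
  by have /forallP/(_ (Ordinal (nj : j < n.+1)))/implyP := H (Ordinal (ni : i < n.+1)); apply.
apply/forallP => i; apply/forallP => j; apply/implyP => Pij.
by apply: H => //; rewrite -ltnS.
Qed.

Definition everywhere (i j : nat) := true.

Lemma dominates_everywhereP n (p s : 'S_n) :
  reflect (forall i j, rk s i j <= rk p i j) (dominates everywhere p s).
Proof.
apply: (iffP (dominatesP _ _ _)) => H i j => [|_ _ _]; last exact: H.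
by rewrite rk_min (rk_min p) H // geq_minr.
Qed.

(** Undoing the inversion at positions i < j moves one entry below w i, so the
    rank function grows by one on a rectangle and is unchanged elsewhere. *)
Lemma rk_reduction n (w : 'S_n) (i j : 'I_n) x y : i < j -> w j < w i ->
  rk (tperm i j * w)%g x y = rk w x y + [&& i < x, x <= j, w j < y & y <= w i].
Proof.
move=> ij wji.
have nij : j != i by rewrite -val_eqE /=; lia.
rewrite /rk (bigD1 i) //= (bigD1 j) //= [in RHS](bigD1 i) //= [in X in _ = _ + X + _](bigD1 j) //=.
have [-> -> Ho] := reductionE w i j.
rewrite (eq_bigr (fun p : 'I_n => ((p < x) && (w p < y)) : nat)); last first.
  by move=> p /andP[pi pj]; rewrite Ho.
move: (\sum_(_ < _ | _) _) => S; lia.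
Qed.

Lemma bruhat_le_dominates n (p s : 'S_n) : bruhat_le p s -> dominates everywhere p s.
Proof.
case/connectP => c; elim: c s => [|s' c IH] s /=.
  by move=> _ ->; apply/dominates_everywhereP.
case/andP => /existsP[i /existsP[j /and3P[ij wji /eqP E]]] /IH{}IH /IH /dominates_everywhereP H.
apply/dominates_everywhereP => x y; apply: leq_trans (H x y).
by rewrite E rk_reduction // leq_addr.
Qed.

Lemma rk_recr n (w : 'S_n) (i : 'I_n) j : rk w i.+1 j = rk w i j + (w i < j).
Proof.
rewrite /rk (bigD1 i) //= [in RHS](bigD1 i) //= ltnn ltnSn /= add0n addnC.
congr (_ + _); apply: eq_bigr => p pi.
by move: pi; rewrite -val_eqE /= ltnS leq_eqVlt => /negbTE ->.
Qed.

(** At the first position i where p and s differ, s i exceeds p i. Among the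
    later positions whose value in s lies in [p i, s i[ take the first one, j:
    the positions strictly between carry no value of that interval, and on
    the rectangle where exchanging i and j raises the rank of s, the entry of p
    at i provides the missing unit. *)
Lemma dominates_step n (p s : 'S_n) : dominates everywhere p s -> p != s ->
  exists2 s', reduction s s' & dominates everywhere p s'.
Proof.
move=> /dominates_everywhereP H neq.
have [i0 Hi0] : exists i, p i != s i.
  apply/existsP; rewrite -negb_forall; apply: contra neq => /forallP E.
  by apply/eqP/permP => x; apply/eqP.
case: (@arg_minnP _ i0 (fun i => p i != s i) val Hi0) => i pi_si min_i {i0 Hi0}.
have agree (x : 'I_n) : x < i -> p x = s x.
  by move=> xi; apply/eqP; apply: contraTT xi => /min_i; rewrite -leqNgt.
have rki y : rk p i y = rk s i y.
  by apply: eq_bigr => x _; case: ltnP => //= /agree ->.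
have lt_i : p i < s i.
  rewrite ltn_neqAle val_eqE pi_si /=.
  have := H i.+1 (s i).+1; rewrite !rk_recr rki leq_add2l ltnSn.
  by case: (ltnP (p i) (s i).+1).
(* The position of the value p i in s is such a candidate. *)
have [j0 [ij0 Hj0]] : exists j : 'I_n, i < j /\ (p i <= s j < s i).
  exists (s^-1%g (p i)); rewrite permKV leqnn lt_i; split=> //.
  rewrite ltnNge leq_eqVlt; apply/norP; split.
    by rewrite val_eqE; apply: contraTneq lt_i => /(congr1 s); rewrite permKV => ->; rewrite ltnn.
  by apply/negP => /agree; rewrite permKV => /perm_inj /(congr1 s); rewrite permKV => E; move: lt_i; rewrite E ltnn.
pose Q (j : 'I_n) := (i < j) && (p i <= s j < s i).
have Qj0 : Q j0 by rewrite /Q ij0.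
case: (@arg_minnP _ j0 Q val Qj0) => j /and3P[ij pj sj] min_j {j0 ij0 Hj0 Qj0}.
exists (tperm i j * s)%g.
  by apply/existsP; exists i; apply/existsP; exists j; rewrite ij sj eqxx.
apply/dominates_everywhereP => x y; rewrite rk_reduction //.
case: and4P => [[ix xj jy yi]|_]; last by rewrite addn0.
have E1 : rk s x y = rk s x (p i) + \sum_(k < n) ((k < i) && (p i <= s k < y)).
  rewrite -big_split /=; apply: eq_bigr => k _.
  case: (ltngtP k i) => ki; last by (rewrite (ord_inj ki); lia).
    by lia.
  have : ~~ ((k < x) && (p i <= s k < s i)).
    apply/negP => /andP[kx kk]; have : Q k by rewrite /Q ki.
    by move/min_j => /=; lia.
  lia.
have E2 : rk p x (p i) + \sum_(k < n) ((k < i) && (p i <= s k < y)) + 1 <= rk p x y.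
  have -> : 1 = \sum_(k < n) (k == i) by rewrite (bigD1 i) //= eqxx big1 // => k /negbTE ->.
  rewrite -!big_split /=; apply: leq_sum => k _.
  case: (ltngtP k i) => ki.
  - have -> : (k == i) = false by apply/negbTE; rewrite -val_eqE /=; lia.
    by rewrite (agree k ki); lia.
  - have -> : (k == i) = false by apply/negbTE; rewrite -val_eqE /=; lia.
    by lia.
  by rewrite (ord_inj ki) eqxx; lia.
by have := H x (p i); lia.
Qed.

(** The reductions of dominates_step increase the sum of all ranks, which the
    ranks of p bound; so they lead from s to p. *)
Lemma bruhat_leE n (p s : 'S_n) : bruhat_le p s = dominates everywhere p s.
Proof.
apply/idP/idP; first exact: bruhat_le_dominates.
(* The termination measure. *)
pose M (w : 'S_n) := \sum_(x < n.+1) \sum_(y < n.+1) rk w x y.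
have [m] := ubnP (M p - M s); elim: m s => // m IH s leM H.
have [->|neq] := eqVneq p s; first exact: connect0.
have [s' red H'] := dominates_step H neq.
apply: (connect_trans (connect1 red)); apply: (IH _ _ H').
suff : M s < M s'.
  have : M s' <= M p.
    by do 2!apply: leq_sum => ? _; move/dominates_everywhereP: H'.
  lia.
case/existsP: red => i /existsP[j /and3P[ij wji /eqP ->]].
rewrite /M (bigD1 (inord j)) //= [in ltnRHS](bigD1 (inord j)) //=.
rewrite -addSn leq_add //; last first.
  by do 2!apply: leq_sum => ? _; rewrite rk_reduction // leq_addr.
rewrite (bigD1 (inord (s i))) //= [in ltnRHS](bigD1 (inord (s i))) //=.
rewrite -addSn leq_add //; last by apply: leq_sum => ? _; rewrite rk_reduction // leq_addr.
have xE (x : 'I_n) : (inord x : 'I_n.+1) = x :> nat by rewrite inordK // ltnW // ltnS.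
by rewrite !xE rk_reduction // ij wji !leqnn addn1.
Qed.

End Rank.

(** * Inserting the first letter, and the Harris inequality *)

Lemma rk_lift0 n (a : 'I_n.+1) (w : 'S_n) i j :
  rk (lift_perm ord0 a w) i.+1 j = ((a < j) + rk w i (unbump a j))%N.
Proof.
rewrite /rk big_ord_recl lift_perm_id /=; congr (_ + _)%N.
apply: eq_bigr => p _; rewrite lift_perm_lift /= /bump /unbump /=.
move: (nat_of_ord (w p)) => x; lia.
Qed.

Lemma sum_lift0 (V : nmodType) n (F : 'S_n.+1 -> V) :
  \sum_w F w = \sum_a \sum_(w : 'S_n) F (lift_perm ord0 a w).
Proof.
rewrite pair_big /=.
apply: (reindex (fun x : 'I_n.+1 * 'S_n => lift_perm ord0 x.1 x.2)).
apply/onW_bij/inj_card_bij; last by rewrite card_prod !card_Sn card_ord factS.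
case=> a v [b w] /= E.
have ab : a = b by rewrite -(lift_perm_id ord0 a v) E lift_perm_id.
subst b; congr (_, _); apply/permP => k.
by apply: (@lift_inj _ a); rewrite -!(lift_perm_lift ord0) E.
Qed.

(** Both ways of increasing ranks are covered: lowering the first letter and
    raising the ranks of the remaining word. *)
Lemma rk_lift0_le n (a b : 'I_n.+1) (p s : 'S_n) i j : (a <= b)%N ->
  (forall y, rk s i y <= rk p i y)%N ->
  (rk (lift_perm ord0 b s) i.+1 j <= rk (lift_perm ord0 a p) i.+1 j)%N.
Proof.
move=> ab H; rewrite !rk_lift0.
have := H (unbump b j); have := rk_lipschitz p i (leq_pred j).
rewrite /unbump; case: (ltnP a j); case: (ltnP b j) => bj aj /=; rewrite ?subn0 ?subn1; lia.
Qed.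

(** Two similarly ordered sequences: the products (f a - f b) (g a - g b) are
    all nonnegative, and summing them gives the inequality. *)
Lemma chebyshev_sum (R : realDomainType) n (f g : 'I_n -> R) :
  (forall a b : 'I_n, (a <= b)%N -> f b <= f a) ->
  (forall a b : 'I_n, (a <= b)%N -> g b <= g a) ->
  (\sum_a f a) * (\sum_a g a) <= n%:R * \sum_a f a * g a.
Proof.
move=> Hf Hg.
have H : 0 <= \sum_a \sum_b (f a - f b) * (g a - g b).
  apply: sumr_ge0 => a _; apply: sumr_ge0 => b _.
  case/orP: (leq_total a b) => ab.
    by apply: mulr_ge0; rewrite subr_ge0 ?Hf ?Hg.
  by rewrite -mulrNN !opprB; apply: mulr_ge0; rewrite subr_ge0 ?Hf ?Hg.
have E : \sum_a \sum_b (f a - f b) * (g a - g b) =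
    (n%:R * (\sum_a f a * g a) - (\sum_a f a) * (\sum_a g a)) *+ 2.
  have E1 : \sum_a \sum_(b < n) (f a * g a) = n%:R * \sum_a f a * g a :> R.
    rewrite mulr_sumr; apply: eq_bigr => a _.
    by rewrite sumr_const card_ord mulr_natl.
  have E2 : \sum_(a < n) \sum_b (f b * g b) = n%:R * \sum_a f a * g a :> R.
    by rewrite sumr_const card_ord mulr_natl.
  have E3 : \sum_a \sum_b (f a * g b) = (\sum_a f a) * (\sum_a g a) :> R.
    by rewrite mulr_suml; apply: eq_bigr => a _; rewrite mulr_sumr.
  have E4 : \sum_a \sum_b (f b * g a) = (\sum_a f a) * (\sum_a g a) :> R.
    by rewrite exchange_big /= E3.
  transitivity (\sum_a \sum_(b < n) (f a * g a) + \sum_(a < n) \sum_b (f b * g b)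
      - \sum_a \sum_b (f a * g b) - \sum_a \sum_b (f b * g a)).
    rewrite -big_split -!sumrB; apply: eq_bigr => a _.
    by rewrite -big_split -!sumrB; apply: eq_bigr => b _ /=; ring.
  by rewrite E1 E2 E3 E4; ring.
by move: H; rewrite E pmulrn_lge0 // subr_ge0.
Qed.

(** Decreasing for the Bruhat order. *)
Definition antitone (R : porderZmodType) n (F : 'S_n -> R) :=
  forall p s, dominates everywhere p s -> F s <= F p.

(** By induction on n: for a fixed first letter a the inductive hypothesis
    applies to the rest of the word, and the conditional sums decrease with a,
    so that Chebyshev's sum inequality handles the choice of a. *)
Lemma harris_perm (R : realDomainType) n (F G : 'S_n -> R) : antitone F -> antitone G ->
  (\sum_w F w) * (\sum_w G w) <= n`!%:R * \sum_w F w * G w.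
Proof.
elim: n F G => [|n IH] F G HF HG.
  have all1 (w : 'S_0) : w = 1%g by apply/permP => -[].
  have E (K : 'S_0 -> R) : \sum_w K w = K 1%g.
    by rewrite (bigD1 1%g) //= big1 ?addr0 // => w; rewrite (all1 w) eqxx.
  by rewrite !E mul1r.
have anti (K : 'S_n.+1 -> R) (HK : antitone K) (a b : 'I_n.+1) p s : (a <= b)%N ->
    dominates everywhere p s -> K (lift_perm ord0 b s) <= K (lift_perm ord0 a p).
  move=> ab /dominates_everywhereP H; apply: HK; apply/dominates_everywhereP.
  by case=> [|i] j; [rewrite rk0 | exact: rk_lift0_le].
have refl (p : 'S_n) : dominates everywhere p p by apply/dominates_everywhereP.
rewrite !sum_lift0 factS natrM -mulrA.
pose f K (a : 'I_n.+1) : R := \sum_(w : 'S_n) K (lift_perm ord0 a w).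
apply: (le_trans (@chebyshev_sum _ _ (f F) (f G) _ _)).
- by move=> a b ab; apply: ler_sum => w _; apply: anti.
- by move=> a b ab; apply: ler_sum => w _; apply: anti.
rewrite ler_wpM2l // mulr_sumr; apply: ler_sum => a _.
by apply: IH => p s; apply: anti.
Qed.

(** The relation p below s improves when p decreases or s increases, hence
    opposite monotonicity in the two arguments. *)
Lemma harris_pairs (R : realDomainType) n (F G : 'S_n -> 'S_n -> R) :
  (forall s, antitone (F^~ s)) -> (forall s, antitone (G^~ s)) ->
  (forall p, antitone (fun s => - F p s)) -> (forall p, antitone (fun s => - G p s)) ->
  (\sum_p \sum_s F p s) * (\sum_p \sum_s G p s)
    <= n`!%:R ^+ 2 * \sum_p \sum_s F p s * G p s.
Proof.
move=> F1 G1 F2 G2; apply: le_trans (harris_perm _ _) _.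
- by move=> p s ps; apply: ler_sum => w _; apply: F1.
- by move=> p s ps; apply: ler_sum => w _; apply: G1.
rewrite expr2 -mulrA ler_wpM2l // mulr_sumr; apply: ler_sum => p _.
have := harris_perm (F2 p) (G2 p); rewrite !sumrN mulrNN => H; apply: (le_trans H).
by rewrite ler_wpM2l //; apply: ler_sum => s _; rewrite mulrNN.
Qed.

(** * Probability of domination on a region *)

Section Prob.
Variable R : realType.

Definition prob n (E : rel 'S_n) : R := (\sum_p \sum_s (E p s)%:R) / n`!%:R ^+ 2.

Lemma indep_unif_probE n (E : rel 'S_n) : indep_unif_prob R E = prob E.
Proof.
rewrite /prob /indep_unif_prob pair_big /= mulr_suml big_mkcond /=.
apply: eq_bigr => xy _; rewrite /unif card_Sn -invfM -expr2.
by case: (E _ _); rewrite ?mul1r ?mul0r.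
Qed.

Lemma fact_gt0R n : 0 < n`!%:R :> R.
Proof. by rewrite ltr0n fact_gt0. Qed.

Lemma fact2_gt0 n : 0 < n`!%:R ^+ 2 :> R.
Proof. by rewrite exprn_gt0 // fact_gt0R. Qed.

Lemma prob_le n (E E' : rel 'S_n) : (forall p s, E p s -> E' p s) -> prob E <= prob E'.
Proof.
move=> H; rewrite ler_pM2r ?invr_gt0 ?fact2_gt0 //.
apply: ler_sum => p _; apply: ler_sum => s _; rewrite ler_nat.
by case: (E p s) (H p s) => //= ->.
Qed.

Lemma eq_prob n (E E' : rel 'S_n) : (forall p s, E p s = E' p s) -> prob E = prob E'.
Proof. by move=> H; apply/le_anti/andP; split; apply: prob_le => p s; rewrite H. Qed.

Lemma prob_ge0 n (E : rel 'S_n) : 0 <= prob E.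
Proof.
apply: divr_ge0; last exact: ltW (fact2_gt0 n).
by apply: sumr_ge0 => p _; apply: sumr_ge0 => s _.
Qed.

Lemma prob_le1 n (E : rel 'S_n) : prob E <= 1.
Proof.
rewrite ler_pdivrMr ?fact2_gt0 // mul1r.
apply: (@le_trans _ _ (\sum_(p : 'S_n) \sum_(s : 'S_n) 1)).
  by apply: ler_sum => p _; apply: ler_sum => s _; rewrite lern1 leq_b1.
by rewrite !sumr_const card_Sn -mulrnA natrM expr2.
Qed.

Lemma prob_prod n (A B : pred 'S_n) : prob (fun p s => A p && B s) =
  ((\sum_p (A p)%:R) / n`!%:R) * ((\sum_s (B s)%:R) / n`!%:R).
Proof.
rewrite mulrACA -invfM -expr2; congr (_ / _).
rewrite mulr_suml; apply: eq_bigr => p _; rewrite mulr_sumr.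
by apply: eq_bigr => s _; rewrite -natrM mulnb.
Qed.

(** Domination on a region is monotone in both words, so the Harris inequality
    applies. *)
Lemma prob_dominatesI n (P Q : nat -> nat -> bool) :
  prob (@dominates n P) * prob (@dominates n Q)
    <= prob (@dominates n (fun i j => P i j || Q i j)).
Proof.
have mono (K : nat -> nat -> bool) : (forall s, antitone (fun p : 'S_n => (dominates K p s)%:R : R))
    /\ (forall p, antitone (fun s : 'S_n => - (dominates K p s)%:R : R)).
  split=> w p s /dominates_everywhereP ps; rewrite ?lerN2 ler_nat.
    case E: (dominates K s w) => //=; rewrite lt0b; apply/dominatesP => i j ni nj Kij.
    by apply: leq_trans (ps i j); move/dominatesP: E; apply.
  case E: (dominates K w p) => //=; rewrite lt0b; apply/dominatesP => i j ni nj Kij.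
  by apply: leq_trans (ps i j) _; move/dominatesP: E; apply.
have [P1 P2] := mono P; have [Q1 Q2] := mono Q.
rewrite /prob mulrACA -invfM -expr2 ler_pdivrMr ?exprn_gt0 ?fact_gt0R //.
apply: le_trans (harris_pairs P1 Q1 P2 Q2) _.
rewrite [X in _ <= _ * X]expr2 [leRHS]mulrA (divfK (lt0r_neq0 (fact2_gt0 n))) [leRHS]mulrC.
apply: ler_wpM2l; first exact: ltW (fact2_gt0 n).
apply: ler_sum => p _; apply: ler_sum => s _; rewrite -natrM mulnb ler_nat.
case: dominatesP => //= HP; case: dominatesP => //= HQ; rewrite lt0b.
by apply/dominatesP => i j ni nj /orP[/HP|/HQ]; apply.
Qed.

Definition rows m (i j : nat) := (i <= m)%N.

(** The two first letters are in the right order with probability more than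
    1/2; when they are, domination of the remaining words on m rows gives it
    on m + 1 rows. *)
Lemma prob_rows_half n m : prob (@dominates n (rows m)) / 2 <= prob (@dominates n.+1 (rows m.+1)).
Proof.
rewrite /prob mulrAC ler_pdivrMr ?fact2_gt0 // factS natrM exprMn.
rewrite -mulrA mulrCA.
set S := \sum_p \sum_s _; set T := \sum_p \sum_s _.
(* Each pair {a, b} is counted at least once by a <= b or b <= a. *)
have half : n.+1%:R ^+ 2 / 2 <= \sum_(a < n.+1) \sum_(b < n.+1) (a <= b)%N%:R :> R.
  rewrite ler_pdivrMr // mulr_natr mulr2n {2}exchange_big /= -!big_split /=.
  apply: (@le_trans _ _ (\sum_(a < n.+1) \sum_(b < n.+1) 1)).
    by rewrite !sumr_const card_ord -mulrnA natrM expr2.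
  apply: ler_sum => a _; rewrite -big_split /=; apply: ler_sum => b _.
  by rewrite -natrD ler1n; case: (ltnP b a) => [ba|_] //; rewrite (ltnW ba) addn1.
have ST : (\sum_(a < n.+1) \sum_(b < n.+1) (a <= b)%N%:R) * S <= T.
  rewrite /T sum_lift0 mulr_suml; apply: ler_sum => a _.
  under [leRHS]eq_bigr do rewrite sum_lift0.
  rewrite exchange_big /= mulr_suml; apply: ler_sum => b _.
  rewrite /S mulr_sumr; apply: ler_sum => p _; rewrite mulr_sumr; apply: ler_sum => s _.
  rewrite -natrM mulnb ler_nat; case: (leqP a b) => //= ab; case: (@dominatesP n (rows m) p s) => //= H.
  rewrite lt0b; apply/dominatesP => -[|i] j ni nj im; first by rewrite rk0.
  apply: rk_lift0_le => // y; rewrite rk_min (rk_min p).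
  by apply: H; rewrite ?geq_minr // /rows; move: im; rewrite /rows; lia.
have S0 : 0 <= S by apply: sumr_ge0 => p _; apply: sumr_ge0 => s _.
have := le_trans (ler_wpM2r S0 half) ST.
have f0 := lt0r_neq0 (fact2_gt0 n); have N0 : n.+1%:R ^+ 2 != 0 :> R by rewrite expf_eq0 pnatr_eq0.
move=> H; rewrite [leRHS](_ : _ = T / n.+1%:R ^+ 2); last first.
  by move: f0 N0; move: (n`!%:R ^+ 2) (n.+1%:R ^+ 2) => f N f0 N0; field; rewrite f0 N0.
rewrite ler_pdivlMr; last by rewrite exprn_gt0 ?ltr0n.
by apply: le_trans H; rewrite [leLHS](_ : _ = n.+1%:R ^+ 2 / 2 * S) //; ring.
Qed.

Lemma prob_everywhere_half n :
  prob (@dominates n everywhere) / 2 <= prob (@dominates n.+1 everywhere).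
Proof.
have rows_all m : prob (@dominates m everywhere) = prob (@dominates m (rows m)).
  apply: eq_prob => p s; apply/dominatesP/dominatesP => H i j ni nj _; exact: H.
by rewrite !rows_all prob_rows_half.
Qed.

Lemma prob_everywhere_ge n k :
  prob (@dominates n everywhere) / 2 ^+ k <= prob (@dominates (n + k) everywhere).
Proof.
elim: k => [|k IH]; first by rewrite addn0 divr1.
rewrite addnS; apply: le_trans (prob_everywhere_half _).
by rewrite exprSr invfM mulrA ler_pM2r ?invr_gt0.
Qed.

Lemma prob_rows_ge n m : 1 / 2 ^+ m <= prob (@dominates n (rows m)).
Proof.
elim: m n => [|m IH] n.
  have -> : prob (@dominates n (rows 0)) = prob (fun p s : 'S_n => true && true).
    apply: eq_prob => p s; apply/dominatesP => i j _ _; rewrite /rows leqn0 => /eqP ->.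
    by rewrite rk0.
  by rewrite (prob_prod xpredT xpredT) sumr_const card_Sn divr1 divff ?mulr1 // gt_eqF ?fact_gt0R.
case: n => [|n].
  have -> : prob (@dominates 0 (rows m.+1)) = prob (@dominates 0 (rows m)).
    by apply: eq_prob => p s; apply/dominatesP/dominatesP => H i j; rewrite leqn0 => /eqP -> *; rewrite rk0.
  apply: le_trans (IH 0%N).
  by rewrite ler_pM2l // lef_pV2 ?posrE ?exprn_gt0 // exprS ler_peMl ?exprn_ge0 // ler1n.
apply: le_trans (prob_rows_half n m).
by rewrite exprSr invfM mulrA ler_pM2r ?invr_gt0.
Qed.

Lemma prob_reindex n (f : 'S_n -> 'S_n) (E : rel 'S_n) : injective f ->
  prob (fun p s => E (f p) (f s)) = prob E.
Proof.
move=> fI; congr (_ / _); rewrite [RHS](reindex_inj fI); apply: eq_bigr => p _.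
by rewrite [RHS](reindex_inj fI).
Qed.

Lemma prob_swap n (E : rel 'S_n) : prob (fun p s => E s p) = prob E.
Proof. by congr (_ / _); rewrite exchange_big. Qed.

Lemma prob_transpose n (P : nat -> nat -> bool) :
  prob (@dominates n (fun i j => P j i)) = prob (@dominates n P).
Proof.
rewrite -(prob_reindex _ (@invg_inj _)); apply: eq_prob => p s.
by apply/dominatesP/dominatesP => H i j ni nj Pij; have := H j i nj ni Pij; rewrite !rk_inv.
Qed.

(** Reversing the values exchanges the roles of p and s, as it reverses the
    Bruhat order, and reflects the region. *)
Lemma prob_revr n (P : nat -> nat -> bool) :
  prob (@dominates n (fun i j => P i (n - j)%N)) = prob (@dominates n P).
Proof.
rewrite -[RHS](prob_reindex _ (@mulIg _ (rev_perm n))) -[RHS]prob_swap; apply: eq_prob => p s.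
have arith (a b c d k : nat) : (a + b = k -> c + d = k -> b <= d -> c <= a)%N by lia.
apply/dominatesP/dominatesP => H i j ni nj Pij; have nj' := leq_subr j n.
  have := H i (n - j)%N ni nj'; rewrite subKn // => /(_ Pij).
  by apply: arith; exact: rk_revr.
have := H i (n - j)%N ni nj' Pij.
by apply: arith; rewrite addnC -[X in (_ + rk _ _ X)%N](subKn nj) rk_revr.
Qed.

Lemma prob_revl n (P : nat -> nat -> bool) :
  prob (@dominates n (fun i j => P (n - i)%N j)) = prob (@dominates n P).
Proof.
by rewrite -prob_transpose (prob_revr n (fun i j => P j i)) prob_transpose.
Qed.

Definition box (a b : nat) (i j : nat) := [&& a <= i <= b & a <= j <= b]%N.

(** The four quadrants are images of each other under the reflections, and
    domination on each of them is positively correlated with the others. *)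
Lemma prob_four_quadrants h :
  prob (@dominates (h + h) (box 0 h)) ^+ 4 <= prob (@dominates (h + h) everywhere).
Proof.
set P := box 0 h; set n := (h + h)%N.
pose P2 i j := P i (n - j)%N; pose P3 i j := P (n - i)%N j; pose P4 i j := P3 i (n - j)%N.
have step A B x : 0 <= x -> x <= prob (@dominates n A) ->
    x * prob (@dominates n B) <= prob (@dominates n (fun i j => A i j || B i j)).
  move=> x0 xA; apply: le_trans (prob_dominatesI _ _ _).
  by apply: ler_wpM2r xA; apply: prob_ge0.
have E2 : prob (@dominates n P2) = prob (@dominates n P) by apply: prob_revr.
have E3 : prob (@dominates n P3) = prob (@dominates n P) by apply: prob_revl.
have E4 : prob (@dominates n P4) = prob (@dominates n P) by rewrite -E3; apply: prob_revr.
set x := prob (@dominates n P) in E2 E3 E4 *.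
have x0 : 0 <= x := prob_ge0 _.
have S2 := step P P2 x x0 (lexx _).
have S3 := step _ P3 _ (mulr_ge0 x0 (prob_ge0 _)) S2.
have S4 := step _ P4 _ (mulr_ge0 (mulr_ge0 x0 (prob_ge0 _)) (prob_ge0 _)) S3.
rewrite E2 E3 E4 in S4; rewrite !exprSr expr0 mul1r; apply: (le_trans S4); apply: prob_le => p s /dominatesP H.
apply/dominatesP => i j ni nj _; apply: H => //.
rewrite /P2 /P4 /P3 /P /box /n; move: ni nj; rewrite /n; lia.
Qed.

(** The border of width m costs a factor 2^-m for its rows and, by
    transposition, the same for its columns. *)
Lemma prob_box h m :
  (1 / 2 ^+ m) ^+ 2 * prob (@dominates (h + h) (box m h)) <= prob (@dominates (h + h) (box 0 h)).
Proof.
have r := prob_rows_ge (h + h) m.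
have r0 : 0 <= 1 / 2 ^+ m :> R by rewrite divr_ge0 ?exprn_ge0.
have S : (1 / 2 ^+ m) ^+ 2 <= prob (@dominates (h + h) (fun i j => rows m i j || rows m j i)).
  apply: le_trans (prob_dominatesI _ _ _); rewrite expr2.
  by apply: ler_pM => //; rewrite (prob_transpose (h + h) (rows m)).
apply: (@le_trans _ _ (prob (@dominates (h + h) (fun i j => (rows m i j || rows m j i) || box m h i j)))).
  by apply: le_trans (prob_dominatesI _ _ _); apply: ler_wpM2r => //; apply: prob_ge0.
apply: prob_le => p s /dominatesP H; apply/dominatesP => i j ni nj Pij; apply: H => //.
by move: Pij; rewrite /box /rows; lia.
Qed.

End Prob.

(** * Independence of rows and columns given the quadrant count *)

(** The words of colors of c and c' are rearrangements of each other. *)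
Lemma recoloring n (K : eqType) (c c' : 'I_n -> K) :
  (forall x, #|[pred i | c i == x]| = #|[pred i | c' i == x]|) ->
  exists t : 'S_n, forall i, c' (t i) = c i.
Proof.
move=> H.
have /tuple_permP[t E] : perm_eq [tuple c i | i < n] [tuple c' i | i < n].
  apply/allP => x _ /=; rewrite !count_map; apply/eqP; have := H x.
  by rewrite !cardE !size_filter /= -!enumT.
exists t => i; have /(congr1 (fun s => nth (c i) s i)) := E.
by rewrite -!tnth_nth !tnth_mktuple => ->.
Qed.

(** Comparing any two fibers both ways makes all fibers over C equal in size, so
    that f is uniform on C given that it lands there; the cardinals clear the
    denominators of the two means. *)
Lemma equidistributed (R : pzRingType) (T S : finType) (f : T -> S) (C : {set S}) (G : S -> R) :
  (forall x y, x \in C -> y \in C ->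
     #|[set w | f w == x]| <= #|[set w | f w == y]|)%N ->
  (\sum_(w | f w \in C) G (f w)) * #|C|%:R =
  #|[set w | f w \in C]|%:R * \sum_(x in C) G x.
Proof.
move=> H.
have [->|[y yC]] := set_0Vmem C.
  rewrite big_pred0 ?mul0r; last by move=> w; rewrite inE.
  by rewrite [X in _ * X]big_pred0 ?mulr0 // => w; rewrite inE.
have E x : x \in C -> #|[set w | f w == x]| = #|[set w | f w == y]|.
  by move=> xC; apply/eqP; rewrite eqn_leq !H.
have part (F : S -> R) : \sum_(w | f w \in C) F (f w) = #|[set w | f w == y]|%:R * \sum_(x in C) F x.
  rewrite (partition_big f (mem C)) //= mulr_sumr; apply: eq_bigr => x xC.
  rewrite -(E x xC) (eq_bigr (fun=> F x)); last by move=> w /andP[_ /eqP ->].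
  rewrite sumr_const mulr_natl; congr (_ *+ _); apply: eq_card => w; rewrite !inE.
  by rewrite -[LHS]/((f w \in C) && (f w == x)); case: eqP => [->|]; rewrite ?andbF ?andbT // xC.
rewrite part -[#|[set w | f w \in C]|]sum1dep_card natr_sum.
rewrite [\sum_(w | f w \in C) _](part (fun=> 1)) sumr_const -mulrA -mulrA; congr (_ * _).
by rewrite mulr_natr mulr_natl.
Qed.

Section Halves.
Local Open Scope nat_scope.
Variable h : nat.
Implicit Types (X Y : {set 'I_(h + h)}) (A B : {set 'I_h}) (w : 'S_(h + h)).

Lemma card_indicator n (A : {set 'I_n}) : #|A| = \sum_(i < n) (i \in A).
Proof. by rewrite -sum1_card big_mkcond; apply: eq_bigr => i _; case: (i \in A). Qed.

Definition initcard n (A : {set 'I_n}) (j : nat) := \sum_(i < n) ((i < j) && (i \in A)).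

(** In terms of the lattice path with a step up at each point of A and a step
    down at each point of B: it never becomes negative. *)
Definition ballot n (A B : {set 'I_n}) := [forall j : 'I_n.+1, initcard B j <= initcard A j].

Definition lo X : {set 'I_h} := [set p | lshift h p \in X].
(** The upper half is read backwards and complemented, so that domination of
    the ranks becomes a ballot condition in the same direction as for lo, and
    so that both halves of a balanced set have the same cardinal. *)
Definition hi X : {set 'I_h} := [set p | rshift h (rev_ord p) \notin X].
Definition halves X := (lo X, hi X).
Definition unhalves (x : {set 'I_h} * {set 'I_h}) : {set 'I_(h + h)} :=
  [set p | match split p with inl q => q \in x.1 | inr q => rev_ord q \notin x.2 end].

Lemma halvesK : cancel halves unhalves.
Proof.
move=> X; apply/setP => p; rewrite !inE.
by case: split_ordP => q ->; rewrite !inE ?rev_ordK ?negbK.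
Qed.

Lemma unhalvesK : cancel unhalves halves.
Proof.
move=> [A B]; congr (_, _); apply/setP => p; rewrite !inE.
  by rewrite (unsplitK (inl p)).
by rewrite (unsplitK (inr _)) /= rev_ordK negbK.
Qed.

Definition lowhalf : {set 'I_(h + h)} := [set p : 'I_(h + h) | p < h].

(** The possible values of lowpos w when w has k entries in the lower left
    quadrant. *)
Definition balanced k : {set {set 'I_(h + h)}} :=
  [set X : {set 'I_(h + h)} | (#|X| == h) && (#|X :&: lowhalf| == k)].

Lemma card_lo X : #|X :&: lowhalf| = #|lo X|.
Proof.
rewrite !card_indicator big_split_ord /= [X in _ + X]big1 ?addn0; last first.
  by move=> i _; rewrite !inE /= ltnNge leq_addr andbF.
by apply: eq_bigr => i _; rewrite !inE /= ltn_ord andbT.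
Qed.

Lemma card_hi X : #|X| + #|hi X| = #|lo X| + h.
Proof.
rewrite !card_indicator big_split_ord /= -addnA; congr (_ + _).
  by apply: eq_bigr => i _; rewrite inE.
rewrite [X in X + _](reindex_inj rev_ord_inj) /= -big_split /=.
rewrite -[RHS](card_ord h) -sum1_card; apply: eq_bigr => i _.
by rewrite inE; case: (_ \in X).
Qed.

Lemma balancedE k X : (X \in balanced k) = (#|lo X| == k) && (#|hi X| == k).
Proof.
rewrite inE card_lo; have := card_hi X; case: eqP; case: eqP; case: eqP; lia.
Qed.

Lemma sum_balanced (V : nmodType) k (F : {set 'I_h} -> {set 'I_h} -> V) :
  (\sum_(X in balanced k) F (lo X) (hi X) =
   \sum_(A : {set 'I_h} | #|A| == k) \sum_(B : {set 'I_h} | #|B| == k) F A B)%R.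
Proof.
rewrite pair_big /= (reindex unhalves) /=; last first.
  by apply: onW_bij; exists halves; [exact: unhalvesK | exact: halvesK].
apply: eq_big => [[A B]|[A B] _] /=; have [E1 E2] := unhalvesK (A, B).
  by rewrite balancedE E1 E2.
by rewrite E1 E2.
Qed.

Lemma card_balanced k : #|balanced k| = 'C(h, k) ^ 2.
Proof.
have := @sum_balanced nat k (fun _ _ => 1); rewrite sum1_card => ->.
have E : #|[pred B : {set 'I_h} | #|B| == k]| = 'C(h, k).
  by rewrite -[in RHS](card_ord h) -card_draws; apply: eq_card => B; rewrite !inE.
by rewrite sum_nat_const sum1_card E expnS expn1.
Qed.

Definition lowpos w : {set 'I_(h + h)} := [set p | w p < h].

Lemma card_lowpos w : #|lowpos w| = h.
Proof.
rewrite -(card_imset _ (@perm_inj _ w)).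
transitivity #|lowhalf|.
  congr #|pred_of_set _|; apply/setP => q; rewrite -[q](permKV w) mem_imset; last exact: perm_inj.
  by rewrite !inE.
rewrite card_indicator big_split_ord /= [X in _ + X]big1 ?addn0; last first.
  by move=> i _; rewrite !inE /= ltnNge leq_addr.
rewrite -[RHS](card_ord h) -sum1_card; apply: eq_bigr => i _.
by rewrite inE /= ltn_ord.
Qed.

Lemma card_lowpos_low w : #|lowpos w :&: lowhalf| = rk w h h.
Proof. by rewrite card_indicator; apply: eq_bigr => p _; rewrite !inE andbC. Qed.

Lemma lowpos_balanced w k : (lowpos w \in balanced k) = (rk w h h == k).
Proof. by rewrite inE card_lowpos eqxx card_lowpos_low. Qed.

Lemma recolor_low X Y : #|X| = #|Y| -> #|X :&: lowhalf| = #|Y :&: lowhalf| ->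
  exists t : 'S_(h + h), (forall p, (t p \in Y) = (p \in X)) /\ (forall p, (t p < h) = (p < h)).
Proof.
move=> c1 c2.
(* Two colors per point: membership in the set and the half it lies in. *)
pose col (Z : {set 'I_(h + h)}) p := (p \in Z, p \in lowhalf).
have cnt Z a b : #|[pred p | col Z p == (a, b)]| =
    if a then (if b then #|Z :&: lowhalf| else #|Z| - #|Z :&: lowhalf|)
    else if b then #|lowhalf| - #|Z :&: lowhalf|
         else #|{: 'I_(h + h)}| - (#|Z| + #|lowhalf| - #|Z :&: lowhalf|).
  have e : #|[pred p | col Z p == (a, b)]| =
     #|(if a then Z else ~: Z) :&: (if b then lowhalf else ~: lowhalf)|.
    apply: eq_card => p; rewrite !inE xpair_eqE.
    by case: a; case: b; rewrite !inE; case: (p \in Z); case: (p < h).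
  rewrite {}e; case: a; case: b => //.
  - by rewrite -setDE cardsD.
  - by rewrite setIC -setDE cardsD setIC.
  - by rewrite -setCU cardsCs setCK cardsU.
have [t H] : exists t : 'S_(h + h), forall p, col Y (t p) = col X p.
  by apply: recoloring => -[a b]; rewrite !cnt c1 c2.
exists t; split=> p; have [] := H p => // _; by rewrite !inE.
Qed.

Lemma fiber_lowpos X Y : #|X| = #|Y| ->
  #|[set w | lowpos w == X]| <= #|[set w | lowpos w == Y]|.
Proof.
move=> c.
have [t H] : exists t : 'S_(h + h), forall p, (t p \in Y) = (p \in X).
  have e (Z : {set 'I_(h + h)}) b :
      #|[pred p | (p \in Z) == b]| = if b then #|Z| else #|{: 'I_(h + h)}| - #|Z|.
    case: b; first by apply: eq_card => p; rewrite !inE eqb_id.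
    transitivity #|~: Z|; last by rewrite cardsCs setCK.
    by apply: eq_card => p; rewrite !inE eqbF_neg.
  by apply: recoloring => b; rewrite !e c.
rewrite -(card_imset _ (@mulgI _ t^-1%g)) subset_leq_card //.
apply/subsetP => _ /imsetP[w + ->]; rewrite !inE => /eqP wX; apply/eqP/setP => p.
by rewrite inE permM -[p in RHS](permKV t) H -wX inE.
Qed.

(** Permuting positions and values inside the two halves carries one fiber to
    the other. *)
Lemma fiber_lowpos2 X Y X' Y' :
  #|X| = #|X'| -> #|X :&: lowhalf| = #|X' :&: lowhalf| ->
  #|Y| = #|Y'| -> #|Y :&: lowhalf| = #|Y' :&: lowhalf| ->
  #|[set w | (lowpos w, lowpos w^-1%g) == (X, Y)]| <=
  #|[set w | (lowpos w, lowpos w^-1%g) == (X', Y')]|.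
Proof.
move=> c1 c2 d1 d2.
have [t [tX tl]] := recolor_low c1 c2; have [u [uY ul]] := recolor_low d1 d2.
pose g (w : 'S_(h + h)) := (t^-1 * w * u)%g.
have gI : injective g by move=> w v /mulIg /mulgI.
rewrite -(card_imset _ gI) subset_leq_card //.
apply/subsetP => _ /imsetP[w + ->]; rewrite !inE !xpair_eqE => /andP[/eqP wX /eqP wY].
apply/andP; split; apply/eqP/setP => p.
  by rewrite inE !permM ul -[p in RHS](permKV t) tX -wX inE.
by rewrite inE /g !invMg invgK !permM tl -[p in RHS](permKV u) uY -wY inE.
Qed.

Definition quadrant_class k := [set w : 'S_(h + h) | rk w h h == k].

(** The set lowpos w is uniform among the sets of h points, so the quadrant
    count follows a hypergeometric law. *)
Lemma card_quadrant k : #|quadrant_class k| * 'C(h + h, h) = (h + h)`! * 'C(h, k) ^ 2.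
Proof.
pose C := [set X : {set 'I_(h + h)} | #|X| == h].
have := @equidistributed int _ _ lowpos C (fun X => (X \in balanced k)%:R).
have -> : [set w | lowpos w \in C] = setT by apply/setP => w; rewrite !inE card_lowpos eqxx.
have -> : #|C| = 'C(h + h, h) by rewrite -[h + h in RHS]card_ord -card_draws.
rewrite cardsT card_Sn -!natr_sum -!natrM => H.
have : ((\sum_(w | lowpos w \in C) (lowpos w \in balanced k)) * 'C(h + h, h) =
       (h + h)`! * (\sum_(X in C) (X \in balanced k))).
  apply/eqP; rewrite -(eqr_nat int); apply/eqP; apply: H => x y; rewrite !inE => /eqP xh /eqP yh.
  by apply: fiber_lowpos; rewrite xh yh.
congr (_ * _ = _ * _).
  rewrite -sum1_card big_mkcond [RHS]big_mkcond /=; apply: eq_bigr => w _.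
  by rewrite !inE card_lowpos eqxx card_lowpos_low; case: (_ == _).
rewrite -card_balanced -sum1_card big_mkcond [RHS]big_mkcond /=; apply: eq_bigr => X _.
by rewrite !inE; case: (_ == h) => //=; case: (_ == k).
Qed.

(** Given the quadrant count, the set of positions of the h smallest values and
    the set of values at the h first positions are independent and uniform
    among balanced sets: all pairs of such sets have fibers of the same size. *)
Lemma quadrant_independent (R : pzRingType) k (G : {set 'I_(h + h)} -> {set 'I_(h + h)} -> R) :
  ((\sum_(w in quadrant_class k) G (lowpos w) (lowpos w^-1%g)) * ('C(h, k) ^ 4)%:R =
   #|quadrant_class k|%:R * \sum_(X in balanced k) \sum_(Y in balanced k) G X Y)%R.
Proof.
have := @equidistributed R _ _ (fun w => (lowpos w, lowpos w^-1%g))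
  (setX (balanced k) (balanced k)) (fun x => G x.1 x.2).
have e w : ((lowpos w, lowpos w^-1%g) \in setX (balanced k) (balanced k)) = (w \in quadrant_class k).
  by rewrite in_setX /= !lowpos_balanced rk_inv andbb inE.
rewrite cardsX card_balanced -expnD (eq_bigl _ _ e) (_ : [set w | _] = quadrant_class k); last first.
  by apply/setP => w; rewrite inE e.
rewrite pair_big /= => H.
rewrite [X in (_ = _ * X)%R](eq_bigl (mem (setX (balanced k) (balanced k)))); last first.
  by case=> x1 x2; rewrite /= in_setX.
apply: H => -[X Y] [X' Y'].
rewrite !in_setX /= !inE => /andP[/andP[/eqP a1 /eqP a2] /andP[/eqP a3 /eqP a4]].
move=> /andP[/andP[/eqP b1 /eqP b2] /andP[/eqP b3 /eqP b4]].
by apply: fiber_lowpos2; congruence.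
Qed.

Lemma initcard_lo w j : j <= h -> initcard (lo (lowpos w)) j = rk w j h.
Proof.
move=> jh; rewrite /rk big_split_ord /= [X in _ + X]big1 ?addn0; last first.
  by move=> i _; rewrite ltnNge (leq_trans jh) ?leq_addr.
by apply: eq_bigr => i _; rewrite !inE.
Qed.

Lemma initcard_hi w j : j <= h -> initcard (hi (lowpos w)) j + h = rk w (h + h - j) h + j.
Proof.
move=> jh.
have jn : j <= h + h by rewrite (leq_trans jh) ?leq_addr.
have -> : initcard (hi (lowpos w)) j = rk (rev_perm _ * w * rev_perm _)%g j h.
  rewrite /rk big_split_ord /= [X in _ = _ + X]big1 ?addn0; last first.
    by move=> i _; rewrite ltnNge (leq_trans jh) ?leq_addr.
  apply: eq_bigr => i _; rewrite !inE !permM !rev_permE /=; congr (_ && _).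
  have -> : rshift h (rev_ord i) = rev_ord (lshift h i).
    by apply: val_inj => /=; have := ltn_ord i; lia.
  by have := ltn_ord (w (rev_ord (lshift h i))); lia.
have h2 : h <= h + h by rewrite leq_addr.
have := rk_revr (rev_perm (h + h) * w)%g jn h2; rewrite addnK.
have := rk_revl w jn h2.
move: (rk _ _ _) (rk _ _ _) (rk _ _ _); lia.
Qed.

(** Only the row of index h of the rank functions is used; the inverses give
    the column of index h. *)
Lemma dominates_ballots (p s : 'S_(h + h)) : dominates everywhere p s ->
  ballot (lo (lowpos p)) (lo (lowpos s)) && ballot (hi (lowpos p)) (hi (lowpos s)).
Proof.
move/dominates_everywhereP => H; apply/andP; split; apply/forallP => j.
  by rewrite !initcard_lo // -1?ltnS.
have jh : j <= h by rewrite -ltnS.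
rewrite -(leq_add2r h) !initcard_hi // leq_add2r; exact: H.
Qed.

Lemma dominates_inv n (p s : 'S_n) : dominates everywhere p s -> dominates everywhere p^-1%g s^-1%g.
Proof.
by move=> /dominates_everywhereP H; apply/dominates_everywhereP => i j; rewrite !rk_inv.
Qed.

End Halves.

(** * Counting ballot pairs of subsets *)

Section Ballot.
Local Open Scope nat_scope.

Definition extend n (x : bool * {set 'I_n}) : {set 'I_n.+1} :=
  [set i | if unlift ord_max i is Some j then j \in x.2 else x.1].

Lemma in_extend_lift n x (i : 'I_n) : (lift ord_max i \in extend x) = (i \in x.2).
Proof. by rewrite inE liftK. Qed.

Lemma in_extend_max n (x : bool * {set 'I_n}) : (ord_max \in extend x) = x.1.
Proof. by rewrite inE unlift_none. Qed.

Lemma extend_bij n : bijective (@extend n).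
Proof.
apply: inj_card_bij; last first.
  have card_sets m : #|{: {set 'I_m}}| = 2 ^ m.
    by rewrite -cardsT -powersetT card_powerset cardsT card_ord.
  by rewrite card_prod card_bool !card_sets expnS.
move=> [b A] [c B] E; congr (_, _).
  by have := in_extend_max (b, A); rewrite E in_extend_max.
by apply/setP => i; have := in_extend_lift (b, A) i; rewrite E in_extend_lift.
Qed.

Lemma initcard_extend n x j :
  initcard (@extend n x) j = initcard x.2 j + ((n < j) && x.1).
Proof.
rewrite /initcard big_ord_recr /= in_extend_max; congr (_ + _).
apply: eq_bigr => i _; congr (_ && _).
have -> : widen_ord (leqnSn n) i = lift ord_max i by apply: ord_inj; rewrite lift_max.
exact: in_extend_lift.
Qed.

Lemma initcard_all n (A : {set 'I_n}) j : n <= j -> initcard A j = #|A|.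
Proof.
move=> nj; rewrite card_indicator; apply: eq_bigr => i _.
by rewrite (leq_trans (ltn_ord i) nj).
Qed.

Lemma card_extend n x : #|@extend n x| = #|x.2| + x.1.
Proof. by rewrite -(@initcard_all n.+1 _ n.+1) // initcard_extend initcard_all // ltnSn. Qed.

Lemma ballotP n (A B : {set 'I_n}) :
  reflect (forall j, j <= n -> initcard B j <= initcard A j) (ballot A B).
Proof.
apply: (iffP forallP) => H j; last by apply: H; rewrite -ltnS.
by move=> jn; apply: (H (Ordinal (jn : j < n.+1))).
Qed.

Lemma ballot_card n (A B : {set 'I_n}) : ballot A B -> #|B| <= #|A|.
Proof. by move/ballotP/(_ n (leqnn n)); rewrite !initcard_all. Qed.

Lemma ballot_extend n x y : ballot (@extend n x) (extend y) =
  ballot x.2 y.2 && (#|y.2| + y.1 <= #|x.2| + x.1).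
Proof.
apply/ballotP/andP => [H|[/ballotP H c] j].
  split; last by rewrite -!card_extend; apply/ballot_card/ballotP.
  apply/ballotP => j jn; have := H j (leqW jn).
  by rewrite !initcard_extend ltnNge jn !addn0.
rewrite leq_eqVlt => /orP[/eqP ->|jn].
  by rewrite !initcard_all // !card_extend.
by rewrite !initcard_extend (leq_gtF (jn : j <= n)) !addn0; apply: H.
Qed.

Definition ballots n k l :=
  \sum_(A : {set 'I_n} | #|A| == k) \sum_(B : {set 'I_n} | #|B| == l) ballot A B.

Lemma sum_extend n (F : {set 'I_n.+1} -> nat) k :
  \sum_(A : {set 'I_n.+1} | #|A| == k) F A =
  \sum_(A : {set 'I_n} | #|A| == k) F (extend (false, A))
  + \sum_(A : {set 'I_n} | #|A|.+1 == k) F (extend (true, A)).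
Proof.
rewrite (reindex _ (onW_bij _ (extend_bij n))) /=.
rewrite (eq_bigl (fun x : bool * {set 'I_n} => #|x.2| + x.1 == k)); last by move=> x; rewrite card_extend.
rewrite -(pair_big_dep xpredT (fun (b : bool) (A : {set 'I_n}) => #|A| + b == k) (fun b A => F (extend (b, A)))) /=.
rewrite big_bool /= addnC; congr (_ + _); apply: eq_bigl => A; by rewrite ?addn0 ?addn1.
Qed.

Lemma ballots_lt n k l : k < l -> ballots n k l = 0.
Proof.
move=> kl; apply: big1 => A /eqP Ak; apply: big1 => B /eqP Bl.
by apply/eqP; rewrite eqb0; apply: contraTN kl => /ballot_card; rewrite Ak Bl -leqNgt.
Qed.

Lemma ballots0 n k : ballots n k 0 = 'C(n, k).
Proof.
rewrite /ballots (eq_bigr (fun=> 1)).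
  rewrite sum1_card -[in RHS](card_ord n) -card_draws.
  by apply: eq_card => A; rewrite !inE.
move=> A _; rewrite (big_pred1 set0) => [|B]; last by rewrite cards_eq0.
suff -> : ballot A set0 by [].
by apply/ballotP => j _; rewrite /initcard big1 // => i _; rewrite inE andbF.
Qed.

Lemma ballotsS n k l : l <= k -> ballots n.+1 k.+1 l.+1 =
  ballots n k.+1 l.+1 + ballots n k l.+1 + ballots n k.+1 l + ballots n k l.
Proof.
move=> lk; rewrite /ballots sum_extend.
have E (b c : bool) k' l' : k' + b = k.+1 -> l' + c = l.+1 ->
  \sum_(A : {set 'I_n} | #|A| == k') \sum_(B : {set 'I_n} | #|B| == l')
    ballot (extend (b, A)) (extend (c, B)) = ballots n k' l'.
  move=> e1 e2; apply: eq_bigr => A /eqP Ak; apply: eq_bigr => B /eqP Bl.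
  by rewrite ballot_extend /= Ak Bl e1 e2 ltnS lk andbT.
under eq_bigr do rewrite sum_extend; under [X in _ + X]eq_bigr do rewrite sum_extend.
rewrite !big_split /=.
have e1 := E false false k.+1 l.+1 (addn0 _) (addn0 _).
have e2 := E false true k.+1 l (addn0 _) (addn1 _).
have e3 := E true false k l.+1 (addn1 _) (addn0 _).
have e4 := E true true k l (addn1 _) (addn1 _).
rewrite e1 e2 e3 e4 -/(ballots n k.+1 l.+1) -/(ballots n k l.+1) -/(ballots n k.+1 l) -/(ballots n k l); lia.
Qed.

(** The reflection principle: the pairs that fail to be ballots number at least
    the product of binomials on the left. Both sides satisfy Pascal's rule in
    the two arguments, with equality on the line l = k. *)
Lemma ballots_le n k l : l <= k -> ballots n k l.+1 + 'C(n, k.+1) * 'C(n, l) <= 'C(n, k) * 'C(n, l.+1).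
Proof.
have base m k' l' : k' = l' -> ballots m k' l'.+1 + 'C(m, k'.+1) * 'C(m, l') <= 'C(m, k') * 'C(m, l'.+1).
  by move=> ->; rewrite ballots_lt // mulnC.
elim: n k l => [|n IH] [|k] l lk; try by apply: base; lia.
  rewrite /ballots.
  rewrite [X in X + _]big1 ?add0n //.
  by move=> A /eqP Ak; have := max_card (mem A); rewrite card_ord Ak.
have [->|lk'] := eqVneq l k.+1; first exact: base.
have {lk lk'} lk : l <= k by lia.
rewrite ballotsS // !binS.
have h1 := IH k.+1 l (leqW lk); have h2 := IH k l lk.
case: l lk h1 h2 => [|l] lk h1 h2.
  rewrite !ballots0 !bin0 in h1 h2 *; nia.
have h3 := IH k.+1 l (leqW (ltnW lk)); have h4 := IH k l (ltnW lk).
rewrite binS; nia.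
Qed.

(** The reflection bound as a proportion of all pairs: it is small when k - l
    is small compared with n. *)
Lemma ballots_ratio n k l : k <= n -> l <= n ->
  ballots n k l * (k.+1 * (n.+1 - l)) <= (k.+1 - l) * n.+1 * ('C(n, k) * 'C(n, l)).
Proof.
move=> kn ln; case: l ln => [|l] ln.
  by rewrite ballots0 bin0 !subn0 muln1 mulnC.
have [kl|lk] := ltnP k l.+1; first by rewrite ballots_lt.
have H := ballots_le n (ltnW lk).
have ck := mul_bin_left n k; have cl := mul_bin_left n l.
have e : (k - l) * n.+1 + (n - k) * l.+1 = k.+1 * (n - l) by nia.
rewrite !subSS -(leq_add2r ((n - k) * l.+1 * ('C(n, k) * 'C(n, l.+1)))) -mulnDl e.
have -> : (n - k) * l.+1 * ('C(n, k) * 'C(n, l.+1)) = ('C(n, k.+1) * 'C(n, l)) * (k.+1 * (n - l)).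
  rewrite mulnACA -ck cl; ring.
by rewrite -mulnDl mulnC leq_mul2l H orbT.
Qed.

End Ballot.

(** * Reduction of the upper bound to four ballots *)

Section Upper.
Variable R : realType.

Lemma sum_quadrant (V : nmodType) h (F : 'S_(h + h) -> V) :
  \sum_w F w = \sum_(k < h.+1) \sum_(w in quadrant_class h k) F w.
Proof.
have lt (w : 'S_(h + h)) : (rk w h h < h.+1)%N by rewrite ltnS rk_le_row.
rewrite (partition_big (fun w => Ordinal (lt w)) xpredT) //=.
by apply: eq_bigr => k _; apply: eq_bigl => w; rewrite inE -val_eqE.
Qed.

Lemma sum_ballot_halves h k l :
  \sum_(X in balanced h k) \sum_(Y in balanced h l)
     (ballot (lo X) (lo Y) && ballot (hi X) (hi Y))%:R = (ballots h k l)%:R ^+ 2 :> R.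
Proof.
rewrite (sum_balanced _ (fun A B => \sum_(Y in balanced h l) (ballot A (lo Y) && ballot B (hi Y))%:R)).
under eq_bigr => A _.
  under eq_bigr => B _.
    rewrite (sum_balanced _ (fun A' B' => (ballot A A' && ballot B B')%:R)).
    under eq_bigr => A' _ do under eq_bigr => B' _ do rewrite -mulnb natrM.
    under eq_bigr => A' _ do rewrite -mulr_sumr.
    rewrite -mulr_suml; over.
  rewrite -mulr_sumr; over.
rewrite -mulr_suml expr2 /ballots natr_sum.
by congr (_ * _); apply: eq_bigr => A _; rewrite natr_sum.
Qed.

(** Domination forces four ballots, one for each half of the middle row and of
    the middle column, and these are independent given the two quadrant
    counts. *)
Lemma quadrant_pairs_le h k l :
  (\sum_(p in quadrant_class h k) \sum_(s in quadrant_class h l) (dominates everywhere p s)%:R)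
     * ('C(h, k) * 'C(h, l))%:R ^+ 4
  <= #|quadrant_class h k|%:R * #|quadrant_class h l|%:R * (ballots h k l)%:R ^+ 4 :> R.
Proof.
pose g (X Y : {set 'I_(h + h)}) : R := (ballot (lo X) (lo Y) && ballot (hi X) (hi Y))%:R.
have le : \sum_(p in quadrant_class h k) \sum_(s in quadrant_class h l) (dominates everywhere p s)%:R <=
  \sum_(p in quadrant_class h k) \sum_(s in quadrant_class h l)
    g (lowpos p) (lowpos s) * g (lowpos p^-1%g) (lowpos s^-1%g).
  apply: ler_sum => p _; apply: ler_sum => s _; rewrite -natrM mulnb ler_nat.
  case: (boolP (dominates everywhere p s)) => // ps.
  by rewrite !dominates_ballots //; exact: dominates_inv.
apply: (le_trans (ler_wpM2r _ le)); first by rewrite exprn_ge0.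
rewrite natrM exprMn mulrA mulrAC mulr_suml -!natrX.
under eq_bigr => p _.
  rewrite (quadrant_independent l (fun X Y => g (lowpos p) X * g (lowpos p^-1%g) Y)).
  under eq_bigr => X _ do rewrite -mulr_sumr.
  rewrite -mulr_suml; over.
rewrite -mulr_sumr -mulrA.
rewrite (quadrant_independent k (fun X Y => (\sum_(i in balanced h l) g X i) * (\sum_(i in balanced h l) g Y i))).
under eq_bigr => X _ do rewrite -mulr_sumr.
rewrite -mulr_suml sum_ballot_halves -exprD mulrA [_%:R * #|quadrant_class h k|%:R]mulrC.
by rewrite natrX.
Qed.

Lemma pow4_add3 (a b c : R) : (a + b + c) ^+ 4 <= 27 * (a ^+ 4 + b ^+ 4 + c ^+ 4).
Proof.
have sq (x y z : R) : (x + y + z) ^+ 2 <= 3 * (x ^+ 2 + y ^+ 2 + z ^+ 2).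
  have := sqr_ge0 (x - y); have := sqr_ge0 (y - z); have := sqr_ge0 (x - z); nra.
have h1 := sq a b c; have h2 := sq (a ^+ 2) (b ^+ 2) (c ^+ 2).
rewrite -!exprM in h2.
rewrite (_ : 4%N = (2 * 2)%N) // exprM.
apply: (@le_trans _ _ ((3 * (a ^+ 2 + b ^+ 2 + c ^+ 2)) ^+ 2)).
  by rewrite lerXn2r // nnegrE ?sqr_ge0 // mulr_ge0 // !addr_ge0 // sqr_ge0.
rewrite exprMn; move: h2; move: (_ + _ + _) (_ + _ + _) => x y; lra.
Qed.

(** Twice the deviation of a quadrant count from its mean h / 2. *)
Definition dev (h k : nat) : R := 2 * k%:R - h%:R.

(** The proportion of ballots is at most of order (k - l + 1) / h when k and l
    are moderate. When k < h / 4 or l > 3 h / 4 a deviation is at least h / 2,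
    and then the trivial bound by 1 is enough. *)
Lemma ballots_frac_le h k l : (0 < h)%N -> (k <= h)%N -> (l <= h)%N ->
  ((ballots h k l)%:R / ('C(h, k) * 'C(h, l))%:R) ^+ 4
    <= 27 * 16 ^+ 4 * (dev h k ^+ 4 + dev h l ^+ 4 + 1) / h%:R ^+ 4.
Proof.
move=> h0 kh lh.
have C0 : (0 < 'C(h, k) * 'C(h, l))%N by rewrite muln_gt0 !bin_gt0 kh.
set g := _ / _.
have g0 : 0 <= g by rewrite divr_ge0.
have hR : 0 < h%:R :> R by rewrite ltr0n.
have CR : 0 < ('C(h, k) * 'C(h, l))%:R :> R by rewrite ltr0n.
have d4 x : 0 <= x ^+ 4 :> R by rewrite -[4%N]/(2 * 2)%N exprM sqr_ge0.
rewrite ler_pdivlMr ?exprn_gt0 //.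
(* 27 * 16^4 = 8^4 * 27 * 16: here 8 comes from the bound on g, 27 from the
   power mean inequality for three terms, and 16 = 2^4 from the term 2. *)
have [/andP[k4 l4]|out] := boolP ((h <= 4 * k)%N && (4 * l <= 3 * h)%N).
  have gh : g * h%:R <= 8 * (dev h k + (- dev h l) + 2) \/ g = 0.
    have [lk|kl] := leqP l k; last by right; rewrite /g ballots_lt // mul0r.
    left; have := ballots_ratio kh lh.
    rewrite -(ler_nat R) !natrM -{1}[_%:R](divfK (lt0r_neq0 CR)) -/g natrM => H.
    have {}H : g * (k.+1%:R * (h.+1 - l)%:R) <= (k.+1 - l)%:R * h.+1%:R.
      rewrite -(ler_pM2r CR); move: H; rewrite natrM; lra.
    have E1 : (k.+1 - l)%:R = k%:R + 1 - l%:R :> R.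
      by rewrite natrB ?leqW // -natr1.
    have E2 : (h.+1 - l)%:R = h%:R + 1 - l%:R :> R.
      by rewrite natrB ?leqW // -natr1.
    have K4 : h%:R <= 4 * k%:R :> R by rewrite -natrM ler_nat.
    have L4 : 4 * l%:R <= 3 * h%:R :> R by rewrite -!natrM ler_nat.
    have LK : l%:R <= k%:R :> R by rewrite ler_nat.
    rewrite E1 E2 -!natr1 in H; rewrite /dev.
    have B : (h%:R + 1) ^+ 2 <= 16 * ((k%:R + 1) * (h%:R + 1 - l%:R)) :> R by nra.
    have B2 : g * (h%:R + 1) * (h%:R + 1) <= 16 * (k%:R + 1 - l%:R) * (h%:R + 1).
      have := ler_wpM2l g0 B; lra.
    have h1 : 0 < h%:R + 1 :> R by rewrite ltr_wpDr.
    rewrite ler_pM2r // in B2; nra.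
  case: gh => [gh|->]; last first.
    by rewrite expr0n mul0r !mulr_ge0 ?addr_ge0 ?d4 ?exprn_ge0.
  rewrite -exprMn.
  apply: (@le_trans _ _ ((8 * (dev h k + - dev h l + 2)) ^+ 4)).
    rewrite lerXn2r // nnegrE; first by rewrite mulr_ge0 // ltW.
    by apply: le_trans gh; rewrite mulr_ge0 // ltW.
  rewrite exprMn.
  have := pow4_add3 (dev h k) (- dev h l) 2; rewrite exprNn -signr_odd mul1r.
  have := d4 (dev h k); have := d4 (dev h l).
  move: (_ ^+ 4) (dev h k ^+ 4) (dev h l ^+ 4) => x y z; lra.
have g1 : g <= 1.
  rewrite ler_pdivrMr // mul1r ler_nat /ballots.
  apply: (@leq_trans (\sum_(A : {set 'I_h} | #|A| == k) \sum_(B : {set 'I_h} | #|B| == l) 1)%N).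
    by apply: leq_sum => A _; apply: leq_sum => B _; apply: leq_b1.
  have E j : #|[pred B : {set 'I_h} | #|B| == j]| = 'C(h, j).
    by rewrite -[in RHS](card_ord h) -card_draws; apply: eq_card => B; rewrite !inE.
  by rewrite sum1_card E sum_nat_const E.
have g4 : g ^+ 4 <= 1 by apply: exprn_ile1.
apply: (@le_trans _ _ (h%:R ^+ 4)); first by rewrite ler_piMl // d4.
have far (x : R) : h%:R ^+ 2 <= 4 * x ^+ 2 -> h%:R ^+ 4 <= 16 * x ^+ 4.
  move=> H; rewrite -[4%N]/(2 * 2)%N !exprM.
  have := sqr_ge0 (h%:R : R); move: (h%:R ^+ 2) (x ^+ 2) H => a b H a0.
  have a1 : 0 <= 4 * b - a by lra.
  have a2 : 0 <= 4 * b + a by lra.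
  by have := mulr_ge0 a1 a2; lra.
have := d4 (dev h k); have := d4 (dev h l).
have [k4|k4] := boolP (h <= 4 * k)%N.
  have L4 : 3 * h%:R < 4 * l%:R :> R by rewrite -!natrM ltr_nat; move: out; rewrite k4 /= -ltnNge.
  have a : 0 <= 4 * l%:R - 3 * h%:R :> R by lra.
  have b : 0 <= 4 * l%:R - h%:R :> R by lra.
  have : h%:R ^+ 4 <= 16 * dev h l ^+ 4.
    by apply: far; rewrite /dev; have := mulr_ge0 a b; lra.
  lra.
have K4 : 4 * k%:R < h%:R :> R by rewrite -natrM ltr_nat ltnNge.
have K0 : 0 <= k%:R :> R by [].
have a : 0 <= h%:R - 4 * k%:R :> R by lra.
have b : 0 <= 3 * h%:R - 4 * k%:R :> R by lra.
have : h%:R ^+ 4 <= 16 * dev h k ^+ 4.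
  by apply: far; rewrite /dev; have := mulr_ge0 a b; lra.
lra.
Qed.

End Upper.

(** * The fourth moment of the quadrant count *)

Section Moment.
Variable R : realType.

Lemma sum_binX2 h : (\sum_(k < h.+1) 'C(h, k) ^ 2 = 'C(h + h, h))%N.
Proof.
rewrite -binomial.Vandermonde; apply: eq_bigr => k _.
by have kh : (k <= h)%N; [rewrite -ltnS | rewrite bin_sub // mulnn].
Qed.

Lemma sum_bin_shift m : (\sum_(j < m.+2) 'C(m.+1, j) * 'C(m.+1, j.+1) = 'C(m.+1 + m.+1, m))%N.
Proof.
rewrite -binomial.Vandermonde big_ord_recr /= [X in (_ + X)%N](_ : _ = 0)%N; last by rewrite (@bin_small m.+1 m.+2) ?muln0.
rewrite addn0; apply: eq_bigr => j _.
have jm : (j <= m)%N by rewrite -ltnS.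
by rewrite -(@bin_sub m.+1 (m - j)) ?leqW ?leq_subr // subSn ?leq_subr // subKn.
Qed.

Lemma mul_central_binS m : (m.+1 * 'C(m.+1 + m.+1, m.+1) = 2 * (m + m).+1 * 'C(m + m, m))%N.
Proof.
have e1 := mul_bin_diag (m.+1 + m.+1) m.
have e2 := mul_bin_down (m + m).+1 m.
rewrite addnS addSn /= in e1 e2 *.
rewrite (_ : (m + m).+1 - m = m.+1)%N in e2; last by lia.
nia.
Qed.

Lemma mul_bin_shift_central m : (m.+2 * 'C(m.+1 + m.+1, m) = m.+1 * 'C(m.+1 + m.+1, m.+1))%N.
Proof. by rewrite mul_bin_left; congr (_ * _)%N; lia. Qed.

(** With u = k (h - k), the fourth power of 2 k - h is (h^2 - 4 u)^2, and the
    absorption identities turn the sums of u and u^2 against the squared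
    binomials into Vandermonde convolutions. *)
Lemma sum_dev4 h : (0 < h)%N ->
  \sum_(k < h.+1) 'C(h, k)%:R ^+ 2 * dev R h k ^+ 4 <= 2 * h%:R ^+ 2 * 'C(h + h, h)%:R.
Proof.
case: h => // -[_|m _].
  have e1 : (2 * 0 - 1) ^+ 4 = 1 :> R by ring.
  have e2 : (2 * 1 - 1) ^+ 4 = 1 :> R by ring.
  by rewrite !big_ord_recr big_ord0 /dev /= bin0 binn (_ : 'C(1 + 1, 1) = 2)%N // e1 e2; lra.
set h := m.+2.
have S0 : \sum_(k < h.+1) 'C(h, k)%:R ^+ 2 = 'C(h + h, h)%:R :> R.
  by rewrite -sum_binX2 natr_sum; apply: eq_bigr => k _; rewrite natrX.
have S1 : \sum_(k < h.+1) 'C(h, k)%:R ^+ 2 * (k%:R * (h%:R - k%:R)) = h%:R ^+ 2 * 'C(m.+1 + m.+1, m)%:R :> R.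
  rewrite -sum_bin_shift natr_sum mulr_sumr big_ord_recl mul0r mulr0 add0r.
  apply: eq_bigr => j _; rewrite lift0.
  have jh : (j.+1 <= h)%N by [].
  have e1 := mul_bin_diag h j; have e2 := mul_bin_down h j.+1.
  have {}e1 : h%:R * 'C(m.+1, j)%:R = j.+1%:R * 'C(h, j.+1)%:R :> R by rewrite -!natrM e1.
  have {}e2 : h%:R * 'C(m.+1, j.+1)%:R = (h%:R - j.+1%:R) * 'C(h, j.+1)%:R :> R.
    by rewrite -natrB // -!natrM e2.
  transitivity ((h%:R * 'C(m.+1, j)%:R) * (h%:R * 'C(m.+1, j.+1)%:R) : R).
    by rewrite e1 e2; ring.
  by rewrite natrM; ring.
have S2 : \sum_(k < h.+1) 'C(h, k)%:R ^+ 2 * (k%:R * (h%:R - k%:R)) ^+ 2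
   = (h%:R * m.+1%:R) ^+ 2 * 'C(m + m, m)%:R :> R.
  rewrite -sum_binX2 natr_sum mulr_sumr big_ord_recl mul0r expr0n mulr0 add0r.
  rewrite big_ord_recr /= /bump /= add1n subrr mulr0 expr0n mulr0 addr0.
  apply: eq_bigr => j _; rewrite /= /bump /= add1n.
  have jh : (j < h)%N by rewrite (leq_trans (ltn_ord j)).
  have e1 := mul_bin_diag h j; have e2 := mul_bin_down m.+1 j.
  have {}e1 : h%:R * 'C(m.+1, j)%:R = j.+1%:R * 'C(h, j.+1)%:R :> R by rewrite -!natrM e1.
  have {}e2 : m.+1%:R * 'C(m, j)%:R = (h%:R - j.+1%:R) * 'C(m.+1, j)%:R :> R.
    by rewrite -natrB // -!natrM e2.
  rewrite natrX -!exprMn -mulrA e2 [_ * (_ * 'C(_, _)%:R)]mulrCA e1; congr (_ ^+ 2); ring.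
have -> : \sum_(k < h.+1) 'C(h, k)%:R ^+ 2 * dev R h k ^+ 4 =
  h%:R ^+ 4 * 'C(h + h, h)%:R - 8 * h%:R ^+ 2 * (h%:R ^+ 2 * 'C(m.+1 + m.+1, m)%:R)
  + 16 * ((h%:R * m.+1%:R) ^+ 2 * 'C(m + m, m)%:R).
  rewrite -S0 -S1 -S2 !mulr_sumr -sumrB -big_split /=; apply: eq_bigr => k _.
  by rewrite /dev; ring.
have c1 : m.+1%:R * 'C(m.+1 + m.+1, m.+1)%:R = 2 * (m + m).+1%:R * 'C(m + m, m)%:R :> R.
  by rewrite -!natrM mul_central_binS.
have c2 : h%:R * 'C(h + h, h)%:R = 2 * (m.+1 + m.+1).+1%:R * 'C(m.+1 + m.+1, m.+1)%:R :> R.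
  by rewrite -!natrM mul_central_binS.
have c3 : h%:R * 'C(m.+1 + m.+1, m)%:R = m.+1%:R * 'C(m.+1 + m.+1, m.+1)%:R :> R.
  by rewrite -!natrM mul_bin_shift_central.
have hE : h%:R = m%:R + 2 :> R by rewrite -[h]addn2 natrD.
have mE : m.+1%:R = m%:R + 1 :> R by rewrite -natr1.
have sE : (m + m).+1%:R = 2 * m%:R + 1 :> R by rewrite -natr1 natrD; ring.
have tE : (m.+1 + m.+1).+1%:R = 2 * m%:R + 3 :> R by rewrite -natr1 natrD mE; ring.
rewrite sE tE hE mE in c1 c2 c3 *.
have m0 : 0 <= m%:R :> R by [].
have C0 : 0 <= 'C(m + m, m)%:R :> R by [].
move: m%:R m0 ('C(m + m, m)%:R) C0 ('C(h + h, h)%:R) ('C(m.+1 + m.+1, m)%:R) ('C(m.+1 + m.+1, m.+1)%:R) c1 c2 c3.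
move=> x x0 c C0 C2 C1' C1 c1 c2 c3.
have p1 : x + 1 != 0 by lra.
have p2 : x + 2 != 0 by lra.
have {}c1 : C1 = 2 * (2 * x + 1) * c / (x + 1) by rewrite -c1; field.
have {}c2 : C2 = 2 * (2 * x + 3) * C1 / (x + 2) by rewrite -c2; field.
have {}c3 : C1' = (x + 1) * C1 / (x + 2) by rewrite -c3; field.
rewrite -subr_ge0 [leRHS](_ : _ = 4 * c * (x + 2) / (x + 1) * (5 * x ^+ 2 + 8 * x + 2)); last first.
  by rewrite c3 c2 c1; field; rewrite p1 p2.
have x1 : 0 < x + 1 by lra.
by rewrite !mulr_ge0 // ?invr_ge0 ?ltW //; nra.
Qed.

Lemma quadrant_fracE h k : #|quadrant_class h k|%:R / (h + h)`!%:R = 'C(h, k)%:R ^+ 2 / 'C(h + h, h)%:R :> R.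
Proof.
apply/eqP; rewrite eqr_div ?pnatr_eq0 -?lt0n ?fact_gt0 ?bin_gt0 ?leq_addr //.
by rewrite -natrX -!natrM card_quadrant mulnC.
Qed.

(** The mean over the quadrant counts of the fourth power of the ballot
    proportion is of order h^2 / h^4. *)
Lemma prob_double_le h : (0 < h)%N ->
  prob R (@dominates (h + h) everywhere) <= 5 * (27 * 16 ^+ 4) / h%:R ^+ 2.
Proof.
move=> h0; pose K : R := 27 * 16 ^+ 4.
have hR : 0 < h%:R :> R by rewrite ltr0n.
have N0 := fact2_gt0 R (h + h).
have B0 : 0 < 'C(h + h, h)%:R :> R by rewrite ltr0n bin_gt0 leq_addr.
pose q (k : 'I_h.+1) : R := 'C(h, k)%:R ^+ 2 / 'C(h + h, h)%:R.
have q1 : \sum_k q k = 1.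
  rewrite /q -mulr_suml -(_ : ('C(h + h, h))%:R = \sum_k _) ?divff ?lt0r_neq0 //.
  by rewrite -sum_binX2 natr_sum; apply: eq_bigr => k _; rewrite natrX.
have q0 k : 0 <= q k by rewrite divr_ge0 // sqr_ge0.
have q4 : \sum_k q k * dev R h k ^+ 4 <= 2 * h%:R ^+ 2.
  rewrite /q; under eq_bigr do rewrite mulrAC.
  by rewrite -mulr_suml ler_pdivrMr // sum_dev4.
apply: (@le_trans _ _ (\sum_k \sum_l q k * q l * (K * (dev R h k ^+ 4 + dev R h l ^+ 4 + 1) / h%:R ^+ 4))).
  rewrite /prob ler_pdivrMr // sum_quadrant mulr_suml; apply: ler_sum => k _.
  under eq_bigr do rewrite sum_quadrant.
  rewrite exchange_big /= mulr_suml; apply: ler_sum => l _.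
  have kh : (k <= h)%N by rewrite -ltnS.
  have lh : (l <= h)%N by rewrite -ltnS.
  have C0 : 0 < ('C(h, k) * 'C(h, l))%:R :> R by rewrite ltr0n muln_gt0 !bin_gt0 kh.
  have H := quadrant_pairs_le R h k l; rewrite -ler_pdivlMr ?exprn_gt0 // in H.
  apply: (le_trans H); rewrite -[leLHS]mulrA -expr_div_n.
  have -> : q k * q l = #|quadrant_class h k|%:R * #|quadrant_class h l|%:R / (h + h)`!%:R ^+ 2.
    by rewrite /q -!quadrant_fracE expr2 invfM mulrACA.
  rewrite [leRHS]mulrAC divfK ?lt0r_neq0 //; apply: ler_wpM2l; first by rewrite mulr_ge0.
  exact: ballots_frac_le.
have -> : \sum_k \sum_l q k * q l * (K * (dev R h k ^+ 4 + dev R h l ^+ 4 + 1) / h%:R ^+ 4) =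
   K / h%:R ^+ 4 * (2 * (\sum_k q k * dev R h k ^+ 4) + 1).
  transitivity (\sum_k K / h%:R ^+ 4 * (q k * dev R h k ^+ 4 + q k * (\sum_k q k * dev R h k ^+ 4) + q k)).
    apply: eq_bigr => k _; transitivity (\sum_l K / h%:R ^+ 4 *
      (q k * dev R h k ^+ 4 * q l + q k * (q l * dev R h l ^+ 4) + q k * q l)).
      by apply: eq_bigr => l _; ring.
    by rewrite -mulr_sumr !big_split /= -!mulr_sumr q1 !mulr1.
  by rewrite -mulr_sumr !big_split /= -mulr_suml q1; ring.
apply: (@le_trans _ _ (K / h%:R ^+ 4 * (5 * h%:R ^+ 2))).
  apply: ler_wpM2l; first by rewrite /K divr_ge0 ?mulr_ge0 ?exprn_ge0.
  have : 1 <= h%:R ^+ 2 :> R by rewrite exprn_ege1 // ler1n.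
  lra.
rewrite le_eqVlt; apply/orP; left; apply/eqP; rewrite /K; field; exact: lt0r_neq0.
Qed.

(** Odd n are reached from n + 1 at the cost of a factor 2. *)
Lemma prob_everywhere_le n : (0 < n)%N ->
  prob R (@dominates n everywhere) <= 40 * (27 * 16 ^+ 4) / n%:R ^+ 2.
Proof.
move=> n0; have nR : 0 < n%:R :> R by rewrite ltr0n.
have E := odd_double_half n; have hn : (n <= 2 * uphalf n <= n + 1)%N.
  by rewrite uphalf_half; move: E; rewrite -mul2n; case: odd; lia.
set h := uphalf n in hn.
have h0 : (0 < h)%N by lia.
have hR : 0 < h%:R :> R by rewrite ltr0n.
have H := prob_double_le h0.
have nh : n%:R <= 2 * h%:R :> R by rewrite -natrM ler_nat; case/andP: hn.
have P2 : prob R (@dominates n everywhere) <= 2 * prob R (@dominates (h + h) everywhere).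
  have [e|] := eqVneq (h + h)%N n.
    by rewrite e ler_peMl ?prob_ge0 // ler1n.
  move=> ne; have -> : (h + h = n.+1)%N by move: ne hn; lia.
  by have := prob_everywhere_half R n; lra.
apply: (le_trans P2); rewrite ler_pdivlMr ?exprn_gt0 //.
rewrite ler_pdivlMr ?exprn_gt0 // in H.
have n2 : n%:R ^+ 2 <= 4 * h%:R ^+ 2 :> R by nra.
have p0 := prob_ge0 R (@dominates (h + h) everywhere).
have := ler_wpM2l p0 n2; lra.
Qed.

End Moment.

(** * Concentration of ranks given the quadrant count *)

Section SecondMoment.
Local Open Scope nat_scope.
Variables h k : nat.
Implicit Types (w t u : 'S_(h + h)) (p q : 'I_(h + h)).

Definition keeps_low t := forall p, (t p < h) = (p < h).

Lemma quadrant_act t w u : keeps_low t -> keeps_low u ->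
  ((t * w * u)%g \in quadrant_class h k) = (w \in quadrant_class h k).
Proof.
move=> kt ku; rewrite !inE; congr (_ == _).
rewrite [RHS](reindex_inj (@perm_inj _ t)); apply: eq_bigr => p _.
by rewrite !permM ku kt.
Qed.

Lemma keeps_low_tperm p q : p < h -> q < h -> keeps_low (tperm p q).
Proof. by move=> ph qh r; case: tpermP => [->|->|//]; rewrite ph qh. Qed.

Lemma low_two_transitive p p' q q' : p < h -> p' < h -> q < h -> q' < h ->
  (p == p') = (q == q') -> exists t, [/\ keeps_low t, t p = q & t p' = q'].
Proof.
move=> hp hp' hq hq' E; pose t1 := tperm p q; pose x := t1 p'.
have k1 : keeps_low t1 by exact: keeps_low_tperm.
have xh : x < h by rewrite k1.
exists (t1 * tperm x q')%g; split.
- by move=> r; rewrite permM (keeps_low_tperm xh hq') k1.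
- rewrite permM /t1 tpermL; have [e|ne] := eqVneq p p'.
    have /eqP qq : q == q' by rewrite -E e.
    by rewrite /x /t1 -e tpermL qq tperm1 perm1.
  rewrite tpermD //; last by rewrite eq_sym -E.
  by rewrite /x /t1 -[X in _ != X](tpermL p q) (inj_eq perm_inj) eq_sym.
- by rewrite permM -/x tpermL.
Qed.

Definition hits p p' q q' := \sum_(w in quadrant_class h k) ((w p == q) && (w p' == q')).

Lemma hits_act t u p p' q q' : keeps_low t -> keeps_low u ->
  hits (t p) (t p') (u q) (u q') = hits p p' q q'.
Proof.
move=> kt ku; have kt' : keeps_low t^-1%g by move=> r; rewrite -kt permKV.
have inj : injective (fun w : 'S_(h + h) => t^-1 * w * u)%g by move=> v w /mulIg /mulgI.
rewrite /hits (reindex_inj inj); apply: eq_big => w; first by rewrite quadrant_act.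
by rewrite !permM !permK !(inj_eq perm_inj).
Qed.

(** Permutations of the small positions and of the small values act on the
    permutations with quadrant count k, and they act doubly transitively on
    the small indices. The case b = true is that of a single cell. *)
Lemma hits_const (b : bool) : exists nu, forall p p' q q',
  p < h -> p' < h -> q < h -> q' < h -> (p == p') = b -> (q == q') = b ->
  hits p p' q q' = nu.
Proof.
pose ok (x : 'I_(h + h) * 'I_(h + h)) := [&& x.1 < h, x.2 < h & (x.1 == x.2) == b].
have [[p0 p0'] /and3P[/= a1 a2 /eqP a3]|none] := pickP ok; last first.
  exists 0 => p p' q q' hp hp' _ _ E _.
  by have := none (p, p'); rewrite /ok /= hp hp' E eqxx.
exists (hits p0 p0' p0 p0') => p p' q q' hp hp' hq hq' E E'.
have [t [kt <- <-]] := low_two_transitive a1 a2 hp hp' (etrans a3 (esym E)).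
have [u [ku <- <-]] := low_two_transitive a1 a2 hq hq' (etrans a3 (esym E')).
exact: hits_act.
Qed.

Lemma sum_low i : i <= h -> \sum_(p < h + h) (p < i) = i.
Proof. by move=> ih; rewrite sum_ltn; apply/minn_idPl; rewrite (leq_trans ih) ?leq_addr. Qed.

(** Sums over ordered pairs of distinct points express the second factorial
    moment. *)
Lemma offdiag_square n (a : 'I_n -> bool) :
  \sum_p \sum_p' [&& a p, a p' & p != p'] + \sum_p a p = (\sum_p a p) ^ 2.
Proof.
rewrite expnS expn1 big_distrl /= -big_split /=; apply: eq_bigr => p _.
rewrite big_distrr /= (bigD1 p) //= [in RHS](bigD1 p) //= eqxx !andbF add0n addnC.
congr (_ + _); first by case: (a p).
by apply: eq_bigr => p' /negbTE ne; rewrite eq_sym ne andbT mulnb.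
Qed.

Lemma sum_rk_quadrant : exists nu, forall i j, i <= h -> j <= h ->
  \sum_(w in quadrant_class h k) rk w i j = i * j * nu.
Proof.
have [nu H] := hits_const true; exists nu => i j ih jh.
transitivity (\sum_(p < h + h) \sum_(q < h + h) (p < i) * (q < j) * hits p p q q).
  rewrite /rk exchange_big; apply: eq_bigr => p _.
  under [RHS]eq_bigr => q _ do rewrite big_distrr /=.
  rewrite exchange_big /=; apply: eq_bigr => w _.
  rewrite (bigD1 (w p)) //= eqxx muln1 mulnb big1 ?addn0 // => q.
  by rewrite eq_sym => /negbTE ->; rewrite muln0.
rewrite -[i in RHS](sum_low ih) -[j in RHS](sum_low jh) -mulnA big_distrl /=.
apply: eq_bigr => p _; rewrite big_distrl big_distrr /=; apply: eq_bigr => q _.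
case: (ltnP p i) => pi //; case: (ltnP q j) => qj; rewrite ?mul0n ?muln0 ?mul1n //.
by apply: H; rewrite ?eqxx // ?(leq_trans pi) ?(leq_trans qj).
Qed.

Lemma sum_rk2_quadrant : exists nu, forall i j, i <= h -> j <= h ->
  \sum_(w in quadrant_class h k) (rk w i j ^ 2 - rk w i j) = (i ^ 2 - i) * (j ^ 2 - j) * nu.
Proof.
have [nu H] := hits_const false; exists nu => i j ih jh.
have off m : m <= h ->
    \sum_(x : 'I_(h + h) * 'I_(h + h)) [&& x.1 < m, x.2 < m & x.1 != x.2] = m ^ 2 - m.
  move=> mh; rewrite -(pair_big xpredT xpredT (fun p p' : 'I_(h + h) => [&& p < m, p' < m & p != p'] : nat)) /=.
  by have := offdiag_square (fun p : 'I_(h + h) => p < m); rewrite sum_low // => <-; rewrite addnK.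
transitivity (\sum_(x : 'I_(h + h) * 'I_(h + h)) \sum_(y : 'I_(h + h) * 'I_(h + h))
    [&& x.1 < i, x.2 < i & x.1 != x.2] * [&& y.1 < j, y.2 < j & y.1 != y.2] * hits x.1 x.2 y.1 y.2).
  under [RHS]eq_bigr => x _.
    under eq_bigr => y _ do rewrite big_distrr /=.
    rewrite exchange_big /=; over.
  rewrite exchange_big /=; apply: eq_bigr => w _.
  have := offdiag_square (fun p : 'I_(h + h) => (p < i) && (w p < j)).
  rewrite -/(rk w i j) => <-; rewrite addnK pair_big /=; apply: eq_bigr => -[p p'] _ /=.
  rewrite (bigD1 (w p, w p')) //= !eqxx muln1 [X in _ = _ + X]big1 ?addn0.
    rewrite mulnb (inj_eq perm_inj); case: (p < i); case: (p' < i); case: (w p < j); case: (w p' < j); case: (p == p') => //.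
  case=> q q'; rewrite xpair_eqE negb_and /= => ne.
  by rewrite [(_ == q) && _](_ : _ = false) ?muln0 //; apply/negbTE; rewrite negb_and eq_sym [w p' == _]eq_sym.
rewrite -(off i ih) -(off j jh) -mulnA big_distrl /=.
apply: eq_bigr => -[p p'] _ /=; rewrite big_distrl big_distrr /=; apply: eq_bigr => -[q q'] _ /=.
case: and3P => [[a1 a2 a3]|_] //; case: and3P => [[b1 b2 b3]|_]; rewrite ?mul0n ?muln0 ?mul1n //.
by apply: H; rewrite ?(leq_trans a1) ?(leq_trans a2) ?(leq_trans b1) ?(leq_trans b2) //; apply/negbTE.
Qed.

End SecondMoment.

Section Variance.
Variable R : realType.

(** The mean of rk w i j when w is uniform with quadrant count k, for i and j
    at most h. *)
Definition mean_rk (h k i j : nat) : R := i%:R * j%:R * k%:R / h%:R ^+ 2.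

(** Sampling without replacement: the second factorial moment is at most the
    square of the mean, so the variance is at most the mean, itself at most h. *)
Lemma variance_quadrant h k i j : (1 < h)%N -> (k <= h)%N -> (i <= h)%N -> (j <= h)%N ->
  \sum_(w in quadrant_class h k) ((rk w i j)%:R - mean_rk h k i j) ^+ 2 <= h%:R * #|quadrant_class h k|%:R.
Proof.
move=> h1 kh ih jh.
have h0 : 0 < h%:R :> R by rewrite ltr0n ltnW.
have h10 : 0 < h%:R - 1 :> R by rewrite subr_gt0 ltr1n.
have [nu1 H1] := sum_rk_quadrant h k; have [nu2 H2] := sum_rk2_quadrant h k.
pose U : R := #|quadrant_class h k|%:R.
have sqn m : (m ^ 2 - m)%:R = m%:R * (m%:R - 1) :> R.
  by case: m => [|m]; [rewrite mul0r | rewrite natrB ?natrX ?leq_pexp2l // ?expnS ?leq_pmulr //; ring].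
have cardE (F : nat) (G : 'S_(h + h) -> nat) : (forall w, w \in quadrant_class h k -> G w = F) ->
    (\sum_(w in quadrant_class h k) G w)%:R = U * F%:R :> R.
  by move=> E; rewrite (eq_bigr (fun=> F)) // sum_nat_const natrM.
have M1 : U * k%:R = h%:R * h%:R * nu1%:R :> R.
  have := H1 h h (leqnn h) (leqnn h) => /(congr1 (fun x => x%:R : R)).
  by rewrite (cardE k) ?natrM // => w; rewrite inE => /eqP.
have M2 : U * (k%:R * (k%:R - 1)) = (h%:R * (h%:R - 1)) ^+ 2 * nu2%:R :> R.
  have := H2 h h (leqnn h) (leqnn h) => /(congr1 (fun x => x%:R : R)).
  rewrite (cardE (k ^ 2 - k)%N) ?natrM ?sqn -?expr2 // => w; rewrite inE => /eqP ->//.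
have S1 : \sum_(w in quadrant_class h k) (rk w i j)%:R = U * mean_rk h k i j.
  have -> : U * mean_rk h k i j = i%:R * j%:R * (U * k%:R) / h%:R ^+ 2 by rewrite /mean_rk; ring.
  rewrite -natr_sum H1 // M1 !natrM; field; exact: lt0r_neq0.
pose V := i%:R * (i%:R - 1) * (j%:R * (j%:R - 1)) * (k%:R * (k%:R - 1)) / (h%:R * (h%:R - 1)) ^+ 2 : R.
have S2 : \sum_(w in quadrant_class h k) ((rk w i j)%:R * ((rk w i j)%:R - 1)) = U * V.
  have -> : U * V = i%:R * (i%:R - 1) * (j%:R * (j%:R - 1)) * (U * (k%:R * (k%:R - 1))) / (h%:R * (h%:R - 1)) ^+ 2.
    by rewrite /V; ring.
  under eq_bigr do rewrite -sqn.
  rewrite -natr_sum H2 // M2 !natrM !sqn; field; by rewrite !lt0r_neq0.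
have -> : \sum_(w in quadrant_class h k) ((rk w i j)%:R - mean_rk h k i j) ^+ 2 =
    U * V + (1 - 2 * mean_rk h k i j) * (U * mean_rk h k i j) + U * mean_rk h k i j ^+ 2.
  have -> : U * mean_rk h k i j ^+ 2 = \sum_(w in quadrant_class h k) mean_rk h k i j ^+ 2.
    by rewrite sumr_const mulr_natl.
  rewrite -S1 -S2 mulr_sumr -!big_split /=; apply: eq_bigr => w _; ring.
have nn m : 0 <= m%:R * (m%:R - 1) :> R by rewrite -sqn.
have frac m : (m <= h)%N -> m%:R * (m%:R - 1) / (h%:R * (h%:R - 1)) <= m%:R ^+ 2 / h%:R ^+ 2 :> R.
  move=> mh; have mR : m%:R <= h%:R :> R by rewrite ler_nat.
  rewrite ler_pdivrMr ?mulr_gt0 // mulrAC ler_pdivlMr ?exprn_gt0 //.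
  have m0 : 0 <= m%:R :> R by [].
  have := mulr_ge0 (mulr_ge0 m0 (ltW h0)) (_ : 0 <= h%:R - m%:R :> R).
  by rewrite subr_ge0 => /(_ mR); lra.
have fi := frac i ih; have fj := frac j jh.
have fk : k%:R * (k%:R - 1) <= k%:R ^+ 2 :> R by have : 0 <= k%:R :> R; [by [] | lra].
have VM : V <= mean_rk h k i j ^+ 2.
  have -> : V = i%:R * (i%:R - 1) / (h%:R * (h%:R - 1)) * (j%:R * (j%:R - 1) / (h%:R * (h%:R - 1))) * (k%:R * (k%:R - 1)).
    by rewrite /V; field; rewrite !lt0r_neq0.
  have -> : mean_rk h k i j ^+ 2 = i%:R ^+ 2 / h%:R ^+ 2 * (j%:R ^+ 2 / h%:R ^+ 2) * k%:R ^+ 2.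
    by rewrite /mean_rk; field; rewrite lt0r_neq0.
  have d0 : 0 <= (h%:R * (h%:R - 1))^-1 :> R by rewrite invr_ge0 nn.
  have a0 m : 0 <= m%:R * (m%:R - 1) / (h%:R * (h%:R - 1)) :> R by rewrite mulr_ge0.
  by apply: ler_pM => //; [rewrite mulr_ge0 | apply: ler_pM].
have muh : mean_rk h k i j <= h%:R.
  rewrite /mean_rk ler_pdivrMr ?exprn_gt0 // [leRHS](_ : _ = h%:R * h%:R * h%:R); last by ring.
  by rewrite !ler_pM // ?mulr_ge0 // ler_nat.
have U0 : 0 <= U by [].
rewrite -/U; have := ler_wpM2l U0 VM; have := ler_wpM2l U0 muh; lra.
Qed.

Lemma chebyshev_quadrant h k i j (lam : R) : (1 < h)%N -> (k <= h)%N -> (i <= h)%N -> (j <= h)%N ->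
  0 < lam ->
  #|[set w in quadrant_class h k | lam < `|(rk w i j)%:R - mean_rk h k i j| ]|%:R
     <= h%:R / lam ^+ 2 * #|quadrant_class h k|%:R.
Proof.
move=> h1 kh ih jh l0; rewrite mulrAC ler_pdivlMr ?exprn_gt0 //.
apply: le_trans (variance_quadrant h1 kh ih jh).
rewrite -sum1_card natr_sum mulr_suml.
rewrite [leRHS](bigID (fun w => lam < `|(rk w i j)%:R - mean_rk h k i j|)) /=.
rewrite -[leLHS]addr0 lerD //; last by apply: sumr_ge0 => w _; apply: sqr_ge0.
rewrite (eq_bigl (fun w => (w \in quadrant_class h k) && (lam < `|(rk w i j)%:R - mean_rk h k i j|))); last first.
  by move=> w; rewrite inE.
apply: ler_sum => w /andP[_ H]; rewrite mul1r -[leRHS]real_normK ?num_real //.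
by rewrite lerXn2r ?nnegrE ?normr_ge0 // ltW.
Qed.

End Variance.

(** * Domination away from the border *)

Section Bulk.
Variable R : realType.

(** A union bound over the B^2 points of the grid. *)
Lemma concentrated_half h k B (f : 'I_B -> nat) (lam : R) : (1 < h)%N -> (k <= h)%N ->
  (forall a, f a <= h)%N -> 0 < lam -> B%:R ^+ 2 * (h%:R / lam ^+ 2) <= 1 / 2 ->
  #|quadrant_class h k|%:R / 2 <=
  #|[set w in quadrant_class h k | [forall a, forall b, `|(rk w (f a) (f b))%:R - mean_rk R h k (f a) (f b)| <= lam]]|%:R :> R.
Proof.
move=> h1 kh fh l0 Hl.
set G := [set w in _ | _].
pose bad a b := [set w in quadrant_class h k | lam < `|(rk w (f a) (f b))%:R - mean_rk R h k (f a) (f b)| ].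
have cover : (#|quadrant_class h k| <= #|G| + \sum_a \sum_b #|bad a b|)%N.
  rewrite -(cardsID G (quadrant_class h k)) leq_add ?subset_leq_card ?subsetIr //.
  rewrite pair_big /= -sum1_card.
  apply: (@leq_trans (\sum_(w in quadrant_class h k :\: G) \sum_(x : 'I_B * 'I_B) (w \in bad x.1 x.2))%N).
    apply: leq_sum => w; rewrite in_setD /G in_set => /andP[+ wm]; rewrite wm /= negb_forall => /existsP[a].
    rewrite negb_forall => /existsP[b]; rewrite -ltNge => lt.
    by rewrite (bigD1 (a, b)) //= in_set wm lt.
  rewrite exchange_big /=; apply: leq_sum => x _.
  rewrite -sum1_card [leqRHS]big_mkcond /= [leqLHS]big_mkcond /=.
  by apply: leq_sum => w _; case: (w \in _ :\: _); case: (w \in bad _ _).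
have M0 : 0 <= #|quadrant_class h k|%:R :> R by [].
have cov2 : #|quadrant_class h k|%:R <= #|G|%:R + (B%:R ^+ 2 * (h%:R / lam ^+ 2)) * #|quadrant_class h k|%:R.
  apply: (@le_trans _ _ (#|G|%:R + \sum_a \sum_b #|bad a b|%:R)).
    move: cover; rewrite -(ler_nat R) natrD natr_sum; move/le_trans; apply.
    by rewrite lerD2l; apply: ler_sum => a _; rewrite natr_sum.
  rewrite lerD2l; apply: (@le_trans _ _ (\sum_(a < B) \sum_(b < B) (h%:R / lam ^+ 2 * #|quadrant_class h k|%:R))).
    by apply: ler_sum => a _; apply: ler_sum => b _; apply: chebyshev_quadrant.
  have E (x : R) : \sum_(a < B) \sum_(b < B) x = B%:R ^+ 2 * x.
    by rewrite !sumr_const !card_ord expr2 -mulrA !mulr_natl.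
  by rewrite E [leLHS]mulrA lexx.
have := ler_wpM2r M0 Hl; lra.
Qed.

(** Rank functions are monotone in both indices. So in a cell of the grid with
    step t the rank of p is at least its value at the lower corner and the rank
    of s at most its value at the upper corner; once these corner values are
    near their means, the gap between the means separates them. *)
Lemma prob_bulk h t B a0 k l (lam : R) : (h = B * t)%N -> (a0 < B)%N -> (0 < t)%N -> (1 < h)%N ->
  (k <= h)%N -> (l <= h)%N -> 0 < lam ->
  B%:R ^+ 2 * (h%:R / lam ^+ 2) <= 1 / 2 ->
  (forall a b, (a0 <= a < B)%N -> (a0 <= b < B)%N ->
     mean_rk R h l (a.+1 * t)%N (b.+1 * t)%N + lam <= mean_rk R h k (a * t)%N (b * t)%N - lam) ->
  (#|quadrant_class h k|%:R / (h + h)`!%:R / 2) * (#|quadrant_class h l|%:R / (h + h)`!%:R / 2)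
    <= prob R (@dominates (h + h) (box (a0 * t) h)).
Proof.
move=> hE a0B t0 h1 kh lh l0 Hl gap.
pose near k' f := [set w in quadrant_class h k' |
  [forall a : 'I_B, forall b : 'I_B, `|(rk w (f a) (f b))%:R - mean_rk R h k' (f a) (f b)| <= lam]].
pose G := near k (fun a : 'I_B => a * t)%N.
pose H := near l (fun a : 'I_B => a.+1 * t)%N.
have GE : #|quadrant_class h k|%:R / 2 <= #|G|%:R :> R.
  by apply: concentrated_half => // a; rewrite hE leq_mul2r ltnW ?orbT.
have HE : #|quadrant_class h l|%:R / 2 <= #|H|%:R :> R.
  by apply: concentrated_half => // a; rewrite hE leq_mul2r ltn_ord orbT.
apply: (@le_trans _ _ (prob R (fun p s => (p \in G) && (s \in H)))); last first.
  apply: prob_le => p s /andP[pG sH].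
  apply/dominatesP => i j _ _ /andP[/andP[ia ih] /andP[ja jh]].
  have cell x : (a0 * t <= x <= h)%N -> exists a : 'I_B, (a0 <= a)%N /\ (a * t <= x <= a.+1 * t)%N.
    case/andP => ax xh; have B0 : (B.-1 < B)%N by case: (B) hE h1 => [->|].
    have m : (minn (x %/ t) B.-1 < B)%N by rewrite gtn_min B0 orbT.
    exists (Ordinal m) => /=.
    have d1 := leq_trunc_div x t; have d2 := ltn_ceil x t0.
    have a0d : (a0 <= x %/ t)%N by rewrite leq_divRL.
    case: (leqP (x %/ t) B.-1) => c.
      by rewrite a0d d1 ltnW.
    have xB : (x %/ t <= B)%N by rewrite -(mulnK B t0) leq_div2r // -hE.
    have xE : (x %/ t = B)%N by lia.
    rewrite (ltn_predK B0); split.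
      by rewrite -ltnS (ltn_predK B0).
    rewrite -hE xh andbT; apply: leq_trans d1; rewrite leq_mul2r xE leq_pred orbT //.
  have [a [a0a /andP[a1 a2]]] := cell i (introT andP (conj ia ih)).
  have [b [b0b /andP[b1 b2]]] := cell j (introT andP (conj ja jh)).
  move: pG sH; rewrite !in_set => /andP[_ /forallP/(_ a)/forallP/(_ b) pG] /andP[_ /forallP/(_ a)/forallP/(_ b) sH].
  have g : mean_rk R h l (a.+1 * t)%N (b.+1 * t)%N + lam <= mean_rk R h k (a * t)%N (b * t)%N - lam.
    by apply: gap; rewrite ?a0a ?b0b /=.
  rewrite ler_norml in pG; rewrite ler_norml in sH.
  case/andP: pG => pG _; case/andP: sH => _ sH.
  apply: (leq_trans (rk_mono s a2 b2)); apply: leq_trans (rk_mono p a1 b1).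
  rewrite -(ler_nat R); lra.
rewrite (prob_prod R (mem G) (mem H)).
have cardE (A : {set 'S_(h + h)}) : \sum_p (p \in A)%:R = #|A|%:R :> R.
  by rewrite -sum1_card natr_sum [RHS]big_mkcond; apply: eq_bigr => p _; case: (p \in A).
rewrite !cardE; have f0 := fact_gt0R R (h + h).
by apply: ler_pM; rewrite ?divr_ge0 // [leLHS]mulrAC ler_pM2r ?invr_gt0.
Qed.

End Bulk.

(** * The exponential rate *)

Section Lower.
Variable R : realType.

Lemma central_bin_ge m : (4 ^ m <= (m + m).+1 * 'C(m + m, m))%N.
Proof.
elim: m => // m IH; rewrite -(@leq_pmul2l m.+1) // mulnCA mul_central_binS expnS.
rewrite addnS addSn; nia.
Qed.

Lemma central_bin_le h : ('C(h + h, h) <= 4 ^ h)%N.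
Proof.
rewrite -[X in 'C(X, _)]card_ord -card_draws (leq_trans (max_card _)) //.
by rewrite -cardsT -powersetT card_powerset cardsT card_ord addnn -muln2 mulnC expnM.
Qed.

(** The ratio of consecutive binomial coefficients of 600 t at the fraction
    315 / 600, which is 285 / 315. *)
Definition rho : R := 19 / 21.

Lemma rho_gt0 : 0 < rho. Proof. by rewrite /rho; lra. Qed.

(** Up to the index 315 t the ratio of consecutive coefficients is at least
    rho. *)
Lemma bin_off_center t j : (j <= 15 * t)%N ->
  'C(600 * t, 300 * t)%:R * rho ^+ j <= 'C(600 * t, 300 * t + j)%:R.
Proof.
elim: j => [|j IH] jt; first by rewrite addn0 expr0 mulr1.
rewrite exprSr mulrA addnS; apply: le_trans (ler_wpM2r (ltW rho_gt0) (IH (ltnW jt))) _.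
set x := (300 * t + j)%N; have e := mul_bin_left (600 * t) x.
have le : 19 * x.+1%:R <= 21 * (600 * t - x)%:R :> R.
  by rewrite -!natrM ler_nat /x; lia.
have {}e : x.+1%:R * 'C(600 * t, x.+1)%:R = (600 * t - x)%:R * 'C(600 * t, x)%:R :> R.
  by rewrite -!natrM e.
have x0 : 0 < x.+1%:R :> R by rewrite ltr0n.
rewrite -(ler_pM2l x0) e /rho.
have := ler_wpM2r (ler0n R 'C(600 * t, x)) le; lra.
Qed.

(** A quadrant count 15 t off its mean costs the factor rho^(15 t) in each of
    the two binomial factors; the denominators come from comparing the central
    coefficients with powers of 2. *)
Lemma quadrant_frac_ge t k : (k = 315 * t)%N \/ (k = 285 * t)%N ->
  rho ^+ (30 * t) / ((600 * t).+1%:R) ^+ 2 <= #|quadrant_class (600 * t) k|%:R / (600 * t + 600 * t)`!%:R.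
Proof.
move=> kE; rewrite quadrant_fracE; set h := (600 * t)%N.
have -> : 'C(h, k) = 'C(h, 315 * t).
  case: kE => -> //; rewrite -(@bin_sub h (315 * t)); last by rewrite /h; lia.
  by congr 'C(_, _); rewrite /h; lia.
have h0 : 0 < h.+1%:R :> R by rewrite ltr0n.
have B0 : 0 < 'C(h + h, h)%:R :> R by rewrite ltr0n bin_gt0 leq_addr.
have r0 := rho_gt0.
have c1 : 'C(h, 300 * t)%:R * rho ^+ (15 * t) <= 'C(h, 315 * t)%:R.
  by have := bin_off_center (leqnn (15 * t)); rewrite -mulnDl.
have c2 : 2 ^+ h <= h.+1%:R * 'C(h, 300 * t)%:R :> R.
  rewrite -natrX -natrM ler_nat; have := central_bin_ge (300 * t).
  have -> : (300 * t + 300 * t = h)%N by rewrite /h; lia.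
  by rewrite -(expnM 2 2) (_ : 2 * (300 * t) = h)%N // /h; lia.
have c3 : 'C(h + h, h)%:R <= (2 ^+ h) ^+ 2 :> R.
  by rewrite -!natrX ler_nat -expnM mulnC expnM central_bin_le.
have c4 : 2 ^+ h * rho ^+ (15 * t) <= h.+1%:R * 'C(h, 315 * t)%:R.
  apply: le_trans (ler_wpM2r (exprn_ge0 _ (ltW r0)) c2) _.
  by rewrite -mulrA ler_pM2l.
rewrite ler_pdivlMr // mulrAC ler_pdivrMr ?exprn_gt0 //.
rewrite [leRHS]mulrC -exprMn (_ : 30 * t = 15 * t * 2)%N; last by lia.
rewrite exprM; apply: le_trans (ler_wpM2l (exprn_ge0 _ (exprn_ge0 _ (ltW r0))) c3) _.
rewrite -exprMn mulrC; by apply: lerXn2r => //; rewrite nnegrE mulr_ge0 ?exprn_ge0 // ltW.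
Qed.

Lemma mean_rk_scale B k x y t : (0 < B)%N -> (0 < t)%N ->
  mean_rk R (B * t)%N (k * t)%N (x * t)%N (y * t)%N
    = t%:R * ((x%:R / B%:R) * (y%:R / B%:R) * k%:R).
Proof.
move=> B0 t0; rewrite /mean_rk !natrM; field.
by rewrite !lt0r_neq0 ?ltr0n.
Qed.

Lemma gap_numeric (x y : R) : 0 <= x - 1 / 10 -> 0 <= y - 1 / 10 ->
  1 / 5 <= x * y * 315 - (x + 1 / 600) * (y + 1 / 600) * 285.
Proof. by move=> x1 y1; have := mulr_ge0 x1 y1; lra. Qed.

(** The counts 315 t and 285 t are far enough apart to absorb both the change
    of the mean across one cell, at most (61 / 60)^2 as a factor when
    a, b >= 60, and the two deviations t / 10. *)
Lemma gap_bulk t a b : (0 < t)%N -> (60 <= a < 600)%N -> (60 <= b < 600)%N ->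
  mean_rk R (600 * t)%N (285 * t)%N (a.+1 * t)%N (b.+1 * t)%N + t%:R / 10
  <= mean_rk R (600 * t)%N (315 * t)%N (a * t)%N (b * t)%N - t%:R / 10.
Proof.
move=> t0 /andP[a60 _] /andP[b60 _].
have tR : 0 < t%:R :> R by rewrite ltr0n.
have aR : 60 <= a%:R :> R by rewrite ler_nat.
have bR : 60 <= b%:R :> R by rewrite ler_nat.
rewrite !mean_rk_scale // -[a.+1%:R]natr1 -[b.+1%:R]natr1 !mulrDl.
set x : R := a%:R / 600; set y : R := b%:R / 600.
have x1 : 0 <= x - 1 / 10 by rewrite /x; lra.
have y1 : 0 <= y - 1 / 10 by rewrite /y; lra.
have H := gap_numeric x1 y1.
have := ler_wpM2l (ltW tR) H. lra.
Qed.

(** The size of t makes the union bound over 600^2 grid points, each failing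
    with probability at most 600 t / (t / 10)^2, in total at most 1/2. *)
Lemma prob_box_ge t : 432 * 10 ^+ 8 <= t%:R :> R ->
  (1 / 2 ^+ (60 * t)) ^+ 2 * ((rho ^+ (30 * t) / (600 * t).+1%:R ^+ 2 / 2) ^+ 2)
   <= prob R (@dominates (600 * t + 600 * t) (box 0 (600 * t))).
Proof.
move=> tbig.
have tR : 0 < t%:R :> R by lra.
have t0 : (0 < t)%N by rewrite ltr0n in tR.
have l0 : 0 < t%:R / 10 :> R by rewrite divr_gt0.
have Hl : 600%:R ^+ 2 * ((600 * t)%:R / (t%:R / 10) ^+ 2) <= 1 / 2 :> R.
  rewrite natrM [leLHS](_ : _ = 216 * 10 ^+ 8 / t%:R); last by field; rewrite lt0r_neq0.
  rewrite ler_pdivrMr //; lra.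
have gap (a b : nat) := @gap_bulk t a b t0.
have k1 : (315 * t <= 600 * t)%N by rewrite leq_mul2r orbT.
have k2 : (285 * t <= 600 * t)%N by rewrite leq_mul2r orbT.
have h1 : (1 < 600 * t)%N by lia.
have H := @prob_bulk R (600 * t) t 600 60 (315 * t) (285 * t) (t%:R / 10) erefl erefl t0 h1 k1 k2 l0 Hl gap.
apply: le_trans (prob_box R (600 * t) (60 * t)).
apply: ler_wpM2l; first by rewrite exprn_ge0 // divr_ge0 // exprn_ge0.
apply: le_trans H; rewrite expr2.
have g1 := @quadrant_frac_ge t (315 * t) (or_introl erefl).
have g2 := @quadrant_frac_ge t (285 * t) (or_intror erefl).
have n0 : 0 <= rho ^+ (30 * t) / (600 * t).+1%:R ^+ 2 / 2.
  by rewrite !divr_ge0 // !exprn_ge0 // ltW // rho_gt0.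
by apply: ler_pM => //; rewrite ler_pM2r ?invr_gt0.
Qed.

(** The numerical heart of the rate: 25 letters are worth rho^5 / 2^11, where
    the factors obtained from the four quadrants amount to rho^5 / 2^10. *)
Lemma rate_25_letters : (708%:R / 1000%:R) ^+ 25 <= rho ^+ 5 * (1 / 2) ^+ 11 :> R.
Proof.
have h1 : (708%:R / 1000%:R) ^+ 5 <= rho * (1 / 5) :> R by rewrite /rho; lra.
have h2 : (1 / 5) ^+ 5 <= (1 / 2) ^+ 11 :> R by lra.
rewrite (_ : 25 = 5 * 5)%N // exprM.
apply: (@le_trans _ _ ((rho * (1 / 5)) ^+ 5)).
  by apply: lerXn2r => //; rewrite nnegrE ?exprn_ge0 ?divr_ge0 // mulr_ge0 // ltW ?rho_gt0 //; lra.
by rewrite exprMn ler_wpM2l // exprn_ge0 // ltW // rho_gt0.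
Qed.

Lemma quadrant_bound_pow (a r H : R) : H != 0 ->
  (a ^+ 2 * (r / H ^+ 2 / 2) ^+ 2) ^+ 4 = a ^+ 8 * r ^+ 8 / H ^+ 16 / 2 ^+ 8.
Proof. by move=> H0; field. Qed.

Lemma exponents t : [/\ (1200 * t = 600 * t + 600 * t)%N, (600 * t + 600 * t = 25 * (48 * t))%N,
  (5 * (48 * t) = 30 * t * 8)%N, (11 * (48 * t) = 60 * t * 8 + 48 * t)%N & (t * 16 <= 48 * t)%N].
Proof. split; lia. Qed.

(** The slack of 2^(48 t) between the two rates pays for the polynomial
    factor (600 t + 1)^16. *)
Lemma prob_multiple_ge t : 432 * 10 ^+ 8 <= t%:R :> R ->
  (708%:R / 1000%:R) ^+ (1200 * t) / (2 ^+ 8 * 601 ^+ 16)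
    <= prob R (@dominates (1200 * t) everywhere).
Proof.
move=> tbig.
have tR : 0 < t%:R :> R by lra.
have t0 : (0 < t)%N by rewrite ltr0n in tR.
have r0 := rho_gt0.
have [e1 e2 e3 e4 e5] := exponents t; rewrite {}e1.
have Q := prob_box_ge tbig.
apply: le_trans (prob_four_quadrants R (600 * t)).
have x0 : 0 <= 708%:R / 1000%:R :> R by rewrite divr_ge0.
set H : R := (600 * t).+1%:R in Q *.
have H0 : 0 < H by rewrite ltr0n.
have Ht : H <= 601 * 2 ^+ t.
  apply: (@le_trans _ _ (601 * t%:R)); first by rewrite -natrM ler_nat (mulSn 600) -[X in (X < _)%N]add0n ltn_add2r.
  by rewrite ler_pM2l // -natrX ler_nat ltnW // ltn_expl.
set r : R := rho ^+ (30 * t) in Q; pose a : R := (1 / 2) ^+ (60 * t).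
have aE : a = 1 / 2 ^+ (60 * t) by rewrite /a expr_div_n expr1n.
have a0 : 0 <= a by rewrite exprn_ge0 // divr_ge0.
have rr0 : 0 <= r by rewrite exprn_ge0 // ltW.
have Q2 : (a ^+ 2 * (r / H ^+ 2 / 2) ^+ 2) ^+ 4 <= prob R (@dominates (600 * t + 600 * t) (box 0 (600 * t))) ^+ 4.
  apply: lerXn2r; rewrite ?nnegrE ?prob_ge0 //.
    by rewrite mulr_ge0 ?exprn_ge0 // !divr_ge0 // exprn_ge0 // ltW.
  by rewrite aE.
apply: le_trans Q2.
rewrite (quadrant_bound_pow a r (lt0r_neq0 H0)).
have h2 : 0 <= 1 / 2 :> R by rewrite divr_ge0.
have rate : (708%:R / 1000%:R) ^+ (600 * t + 600 * t) <= a ^+ 8 * r ^+ 8 * (1 / 2) ^+ (48 * t) :> R.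
  rewrite e2 exprM; apply: (@le_trans _ _ ((rho ^+ 5 * (1 / 2) ^+ 11) ^+ (48 * t))).
    apply: lerXn2r rate_25_letters; rewrite nnegrE; first exact: (exprn_ge0 25 x0).
    exact: (mulr_ge0 (exprn_ge0 5 (ltW r0)) (exprn_ge0 11 h2)).
  rewrite exprMn /a /r -!exprM.
  by rewrite e3 e4 exprD mulrA [rho ^+ _ * _]mulrC lexx.
have poly : (1 / 2) ^+ (48 * t) * H ^+ 16 <= 601 ^+ 16.
  have h21 : 1 / 2 <= 1 :> R by lra.
  apply: (@le_trans _ _ ((1 / 2) ^+ (t * 16) * H ^+ 16)).
    rewrite ler_wpM2r ?exprn_ge0 ?(ltW H0) //.
    exact: ler_wiXn2l.
  rewrite exprM -exprMn; apply: lerXn2r; rewrite ?nnegrE ?mulr_ge0 ?exprn_ge0 ?(ltW H0) //.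
  have p0 : 0 < 2 ^+ t :> R by rewrite exprn_gt0.
  rewrite expr_div_n expr1n mulrC mulrA mulr1 ler_pdivrMr //.
have ar0 : 0 <= a ^+ 8 * r ^+ 8 := mulr_ge0 (exprn_ge0 8 a0) (exprn_ge0 8 rr0).
rewrite invfM mulrA [leLHS]mulrAC ler_pM2r ?invr_gt0 ?exprn_gt0 //.
rewrite ler_pdivrMr ?exprn_gt0 // mulrAC ler_pdivlMr ?exprn_gt0 //.
apply: (@le_trans _ _ (a ^+ 8 * r ^+ 8 * (1 / 2) ^+ (48 * t) * H ^+ 16)).
  by rewrite ler_wpM2r // exprn_ge0 // ltW.
by rewrite -[leLHS]mulrA ler_wpM2l.
Qed.

(** Every n is a multiple of 1200 plus at most 1199 letters, each of which
    costs a factor 2; the finitely many n below the threshold are covered by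
    the bound 2^-n. *)
Lemma prob_everywhere_lower : exists2 c : R, 0 < c & forall n,
  c * (708%:R / 1000%:R) ^+ n <= prob R (@dominates n everywhere).
Proof.
have [t0 Ht0] : exists t0 : nat, 432 * 10 ^+ 8 <= t0%:R :> R.
  by exists (Num.bound (432 * 10 ^+ 8 : R)); rewrite ltW // archi_boundP // mulr_ge0 // exprn_ge0.
set x : R := 708%:R / 1000%:R.
have x0 : 0 <= x by rewrite divr_ge0.
have x1 : x <= 1 by rewrite ler_pdivrMr // mul1r ler_nat.
pose D : R := 2 ^+ 8 * 601 ^+ 16.
have D0 : 0 < D by rewrite mulr_gt0 // exprn_gt0.
have D1 : 1 <= D by rewrite mulr_ege1 // exprn_ege1 // ler1n.
pose N := (1200 * t0.+1)%N; pose E : R := 2 ^+ N.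
have E0 : 0 < E by rewrite exprn_gt0.
exists (D^-1 / E); first by rewrite divr_gt0 ?invr_gt0.
move=> n.
have xn1 : x ^+ n <= 1 by rewrite exprn_ile1.
have [small|large] := ltnP n N.
  have P0 : prob R (@dominates 0 everywhere) = 1.
    have -> : prob R (@dominates 0 everywhere) = prob R (@dominates 0 (rows 0)).
      by apply: eq_prob => p s; apply/dominatesP/dominatesP => H i j ni nj _; apply: H.
    by apply/le_anti; rewrite prob_le1 /= -[leLHS]divr1 -[X in _ / X](expr0 (2 : R)) prob_rows_ge.
  have := prob_everywhere_ge R 0 n; rewrite P0 add0n; apply: le_trans.
  apply: (@le_trans _ _ (D^-1 / E)); first by rewrite ler_piMr // ltW // divr_gt0 ?invr_gt0.
  apply: ler_pM; [by rewrite invr_ge0 ltW | by rewrite invr_ge0 ltW | by rewrite invf_le1 |].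
  rewrite lef_pV2 ?posrE ?exprn_gt0 // ler_weXn2l // ?ler1n // ltnW //.
have nE := divn_eq n 1200; set t := (n %/ 1200)%N in nE; set r := (n %% 1200)%N in nE.
have tt0 : (t0 <= t)%N by rewrite leq_divRL //; apply: leq_trans large; rewrite /N; lia.
have r1200 : (r < 1200)%N by rewrite ltn_mod.
have big : 432 * 10 ^+ 8 <= t%:R :> R by apply: le_trans Ht0 _; rewrite ler_nat.
rewrite nE mulnC; apply: le_trans (prob_everywhere_ge R _ _).
have xle : x ^+ (1200 * t + r) <= x ^+ (1200 * t) by rewrite exprD ler_piMr ?exprn_ge0 ?exprn_ile1.
rewrite mulrAC; apply: ler_pM.
- by rewrite mulr_ge0 ?exprn_ge0 // invr_ge0 ltW.
- by rewrite invr_ge0 ltW.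
- apply: le_trans (prob_multiple_ge big); rewrite mulrC.
  by rewrite ler_wpM2r // invr_ge0 ltW.
- rewrite lef_pV2 ?posrE ?exprn_gt0 // /E ler_weXn2l // ?ler1n // ltnW // (leq_trans r1200) //.
  by rewrite /N leq_pmulr.
Qed.

End Lower.

Theorem theorem1 (R : realType) :
  exists c1 c2 : R,
    [/\ 0 < c1, 0 < c2
      & forall n : nat, (1 <= n)%N ->
          c1 * (708%:R / 1000%:R) ^+ n
            <= indep_unif_prob R (@bruhat_le n)
            <= c2 / n%:R ^+ 2].
Proof.
have [c1 c1_gt0 lower] := prob_everywhere_lower R.
exists c1, (40 * (27 * 16 ^+ 4)); split=> // [|n n_gt0].
  by rewrite !mulr_gt0 // exprn_gt0.
have -> : indep_unif_prob R (@bruhat_le n) = prob R (@dominates n everywhere).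
  by rewrite indep_unif_probE; apply: eq_prob => p s; exact: bruhat_leE.
by rewrite lower prob_everywhere_le.
Qed.
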